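(* Let $N\ge2$, $s\in(1/2,1)$, $q_1,q_2>1$, and let $V\colon(0,+\infty)\to[0,+\infty)$ and $K\colon(0,+\infty)\to(0,+\infty)$ be continuous. If \[ \lim_{R\to0^+}\mathcal S_0(q_1,R)=\lim_{R\to+\infty}\mathcal S_\infty(q_2,R)=0, \] then $H^s_{V,\mathrm{rad}}(\mathbb{R}^N)$ is compactly embedded into $L^{q_1}_K(\mathbb{R}^N)+L^{q_2}_K(\mathbb{R}^N)$.
   Context: $B_R$ is the open ball of radius $R$ centered at the origin, $B_R^c$ its complement. For $0<s<1$, $2^*_s=\frac{2N}{N-2s}$, $C(N,s)=\left(\int_{\mathbb{R}^N}\frac{1-\cos\zeta_1}{|\zeta|^{N+2s}}d\zeta\right)^{-1}$, $[u]_{H^s}=\left(\frac{C(N,s)}{2}\iint_{\mathbb{R}^N\times\mathbb{R}^N}\frac{|u(x)-u(y)|^2}{|x-y|^{N+2s}}dx\,dy\right)^{1/2}$, $\dot H^s(\mathbb{R}^N)=\{u\in L^{2^*_s}(\mathbb{R}^N):[u]_{H^s}<\infty\}$, $H^s_V(\mathbb{R}^N)=\{u\in\dot H^s(\mathbb{R}^N):\int V(|x|)|u|^2dx<\infty\}$ with norm $\|u\|^2=[u]_{H^s}^2+\int_{\mathbb{R}^N}V(|x|)|u|^2dx$, and $H^s_{V,\mathrm{rad}}(\mathbb{R}^N)$ is the subspace of radial functions. $L^q_K(\mathbb{R}^N)=L^q(\mathbb{R}^N,K(|x|)dx)$, and $L^{q_1}_K+L^{q_2}_K=\{u_1+u_2:u_i\in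 L^{q_i}_K\}$ with norm $\inf_{u=u_1+u_2}\max\{\|u_1\|_{L^{q_1}_K},\|u_2\|_{L^{q_2}_K}\}$. For $q>1$, $R>0$: $\mathcal S_0(q,R)=\sup\{\int_{B_R}K(|x|)|u|^qdx: u\in H^s_{V,\mathrm{rad}},\|u\|=1\}$ and $\mathcal S_\infty(q,R)=\sup\{\int_{B_R^c}K(|x|)|u|^qdx: u\in H^s_{V,\mathrm{rad}},\|u\|=1\}$. *)

(* Defs.v *)
From HB Require Import structures.
From mathcomp Require Import all_boot all_order all_algebra.
From mathcomp Require Import all_classical all_reals all_analysis.
Set Implicit Arguments. Unset Strict Implicit. Unset Printing Implicit Defensive.
Import Order.TTheory GRing.Theory Num.Theory.
Import numFieldNormedType.Exports.
Local Open Scope classical_set_scope.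
Local Open Scope ring_scope.

Definition box (R : realType) (N : nat) (a b : 'I_N -> R) : set ('I_N -> R) :=
  [set x | forall i, a i <= x i <= b i].

Definition boxes (R : realType) (N : nat) : set (set ('I_N -> R)) :=
  [set B | exists a b, B = box a b].

Definition RN (R : realType) (N : nat) := g_sigma_algebraType (@boxes R N).

(* mu is (the restriction to Borel sets of) the Lebesgue measure of R^N:
   the measure on the box-generated sigma-algebra giving each box its volume
   (such a measure exists and is unique). *)
Definition is_lebesgue (R : realType) (N : nat)
    (mu : {measure set (RN R N) -> \bar R}) : Prop :=
  forall a b : 'I_N -> R, (forall i, a i <= b i) ->
    mu (box a b) = (\prod_(i < N) (b i - a i))%:E.

Definition enorm (R : realType) (N : nat) (x : 'I_N -> R) : R :=
  Num.sqrt (\sum_(i < N) x i ^+ 2).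

Definition ball0 (R : realType) (N : nat) (r : R) : set (RN R N) :=
  [set x | enorm x < r].

Section Spaces.
Variables (R : realType) (N : nat) (mu : {measure set (RN R N) -> \bar R}).
Variables (s : R) (V K : R -> R).
Local Open Scope ereal_scope.

(* C(N,s) ; zeta_1 is the coordinate of index 0 *)
Definition CNs : R :=
  (fine (\int[mu]_z (((1 - cos (\sum_(i < N | (i : nat) == 0%N) z i))
      / (enorm z `^ (N%:R + 2 * s)))%R)%:E))^-1.

Definition crit_exp : R := (2 * N%:R / (N%:R - 2 * s))%R.

Definition gagliardo2 (u : RN R N -> R) : \bar R :=
  ((CNs / 2)%R)%:E * \int[mu]_x \int[mu]_y
      ((`|u x - u y| ^+ 2 / (enorm (fun i => x i - y i) `^ (N%:R + 2 * s)))%R)%:E.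

Definition Vpart (u : RN R N -> R) : \bar R :=
  \int[mu]_x (V (enorm x) * `|u x| ^+ 2)%R%:E.

Definition Hnorm2 (u : RN R N -> R) : \bar R := gagliardo2 u + Vpart u.
Definition Hnorm (u : RN R N -> R) : \bar R := Hnorm2 u `^ (2^-1)%R.

Definition radial (u : RN R N -> R) : Prop :=
  forall x y, enorm x = enorm y -> u x = u y.

Definition HsVrad (u : RN R N -> R) : Prop :=
  [/\ measurable_fun setT u,
      \int[mu]_x (`|u x| `^ crit_exp)%:E < +oo,
      gagliardo2 u < +oo,
      Vpart u < +oo &
      radial u].

Definition LqK_int (q : R) (f : RN R N -> R) : \bar R :=
  \int[mu]_x (K (enorm x) * `|f x| `^ q)%R%:E.

Definition in_LqK (q : R) (f : RN R N -> R) : Prop :=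
  measurable_fun setT f /\ LqK_int q f < +oo.

Definition LqK_norm (q : R) (f : RN R N -> R) : \bar R :=
  LqK_int q f `^ (q^-1)%R.

Definition in_sum (q1 q2 : R) (u : RN R N -> R) : Prop :=
  exists u1 u2, [/\ in_LqK q1 u1, in_LqK q2 u2 &
    u = (fun x => u1 x + u2 x)%R].

Definition sum_norm (q1 q2 : R) (u : RN R N -> R) : \bar R :=
  ereal_inf [set e | exists u1 u2,
     [/\ in_LqK q1 u1, in_LqK q2 u2, u = (fun x => u1 x + u2 x)%R &
          e = Order.max (LqK_norm q1 u1) (LqK_norm q2 u2)]].

Definition S0 (q r : R) : \bar R :=
  ereal_sup [set \int[mu]_(x in ball0 r) (K (enorm x) * `|u x| `^ q)%R%:E |
     u in [set u | HsVrad u /\ Hnorm u = 1]].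

Definition Sinf (q r : R) : \bar R :=
  ereal_sup [set \int[mu]_(x in ~` ball0 r) (K (enorm x) * `|u x| `^ q)%R%:E |
     u in [set u | HsVrad u /\ Hnorm u = 1]].

Definition compact_embedding (q1 q2 : R) : Prop :=
  [/\ (forall u, HsVrad u -> in_sum q1 q2 u),
      (exists C : R, forall u, HsVrad u -> sum_norm q1 q2 u <= C%:E * Hnorm u) &
      (forall un : nat -> RN R N -> R,
         (forall n, HsVrad (un n)) ->
         (exists M : R, forall n, Hnorm (un n) <= M%:E) ->
         exists phi : nat -> nat,
           {homo phi : m n / (m < n)%N >-> (m < n)%N} /\
           exists v, in_sum q1 q2 v /\
             (fun n => sum_norm q1 q2 (fun x => un (phi n) x - v x)%R) @ \oo --> 0)].

End Spaces.

(* Main.v *)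
(** Only the dilations of R^N are used: they rescale Lebesgue measure, which is
    determined by its values on boxes, and they act on radial functions as
    multiplication of the radius.

    Averaging over a cube of half-width h at x gives, for |l - 1| <= h and
    1 <= |x| <= b,
      |u(x) - u(l x)|^2 <= C h^(2s) (k(x) + k(l x)),
    where k is the inner Gagliardo integral.  For radial u the substitution
    y = |x| y' turns this into a bound C h^(1+2s) int_S k for the double
    integral of |u(x) - u(y)|^2 over a shell S of thickness h, and repeated
    bisection of the shell (this is where s > 1/2 enters) shows that u is a.e.
    within C h^(s-1/2) [u] of a constant on S.  Comparing the constants on
    overlapping dyadic shells, and using that u is in L^p near infinity, gives
    |u(x)| <= C |x|^(s-N/2) [u].  A diagonal argument on the constants attached
    to finer and finer shells then extracts from a bounded sequence a
    subsequence which is uniformly Cauchy on every annulus, up to null sets.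

    On small balls and outside large ones the hypotheses on S_0 and S_infinity
    control the differences u_n - u_m, on the remaining annulus uniform
    convergence does; Fatou's lemma in m passes to the limit v, so that v itself
    need not be known to lie in H^s_V. *)

Require Import Defs.
From HB Require Import structures.
From mathcomp Require Import all_boot all_order all_algebra.
From mathcomp Require Import ring lra.
From mathcomp Require Import all_classical all_reals all_analysis.
From mathcomp Require Import measurable_realfun.
Set Implicit Arguments. Unset Strict Implicit. Unset Printing Implicit Defensive.
Import Order.TTheory GRing.Theory Num.Theory.
Import numFieldNormedType.Exports.
Local Open Scope classical_set_scope.
Local Open Scope ring_scope.

(** * Measurable maps and the Euclidean norm *)

Section MeasurableMaps.
Context {R : realType} {N : nat}.

(** Bisection succeeds because of the power in the energy bound. On a shell of thickness [h] the
    mean square deviation of [u] from a suitable value is at most of order [h ^ (2s - 1)] times the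
    energy, so the values attached to a shell and to one of its halves differ by order
    [h ^ (s - 1/2)], and along nested halvings these jumps form a convergent geometric series
    exactly when [s > 1/2]. The pointwise bound is not read off at Lebesgue points: the squared
    excess of [|u - A|] over the sum of the series has an integral bounded by ever smaller multiples
    of the total energy, since the energies of the pieces add up, hence it is zero.

    Shells are measured in the N-th power of the radius, which makes volume proportional to
    thickness. From [s < 1] and [N >= 2] comes [2s < N], so that the constants on dyadic shells
    telescope; [s < 1] also makes the integral defining [C(N,s)] converge at the origin. That
    convergence must be proved: a divergent integral would be read as 0 and erase the Gagliardo term
    from the norm.

    All bounds hold off null sets that depend on the indices, so every family of indices is kept
    countable. *)

Lemma measurable_box (a b : 'I_N -> R) : measurable (box a b : set (RN R N)).
Proof. by apply: sub_sigma_algebra; exists a, b. Qed.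

Lemma measurable_coord (i : 'I_N) : measurable_fun setT (fun x : RN R N => x i).
Proof.
apply: (measurability _ (RGenInftyO.measurableE R)) => _ [_ [c ->] <-].
(* Boxes are closed and bounded, so the open half space is exhausted by boxes whose [i]-th side ends
   at [c - 1/(n+1)] while all other bounds grow with [n]. *)
have -> : [set: RN R N] `&` (fun x : RN R N => x i) @^-1` `]-oo, c[ =
  \bigcup_n box (fun _ => - n%:R) (fun j => if j == i then c - n.+1%:R^-1 else n%:R).
  apply/seteqP; split=> [x [_ /=]|x [n _ bx]].
    rewrite in_itv/= => xc.
    have /ltr_add_invr[m hm] := xc.
    pose M := \sum_j `|x j|.
    have xM j : `|x j| <= M.
      by rewrite /M (bigD1 j)//= lerDl sumr_ge0.
    exists (maxn m (Num.truncn M).+1) => // j.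
    have Mn : M <= (maxn m (Num.truncn M).+1)%:R.
      by rewrite (le_trans (ltW (truncnS_gt M)))// ler_nat leq_maxr.
    have := le_trans (xM j) Mn; rewrite ler_norml => /andP[-> xn] /=.
    case: eqP => [->|//].
    rewrite lerBrDr (le_trans _ (ltW hm))// lerD2l lef_pV2 ?posrE//.
    by rewrite ler_nat ltnS leq_maxl.
  split=> //=; rewrite in_itv/=.
  have /andP[_] := bx i; rewrite eqxx => /le_lt_trans -> //.
  by rewrite ltrBlDr ltrDl invr_gt0.
by apply: bigcup_measurable => n _; exact: measurable_box.
Qed.

Lemma measurable_toRN d (T : measurableType d) (f : T -> RN R N) :
  (forall i, measurable_fun setT (fun t => f t i)) -> measurable_fun setT f.
Proof.
move=> mf.
apply: (@measurability _ _ _ _ setT f (@boxes R N)) => // _ [_ [a [b ->]] <-].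
rewrite setTI.
have -> : f @^-1` box a b = \bigcap_(i in [set` enum 'I_N]) ((fun t => f t i) @^-1` `[a i, b i]).
  apply/seteqP; split=> [t h i _ /=|t h i]; first by rewrite in_itv/=; exact: h.
  by have /= := h i; rewrite in_itv/= mem_enum; apply.
apply: fin_bigcap_measurable => // 
i _; rewrite -[X in measurable X]setTI.
by apply: mf => //; exact: measurable_itv.
Qed.

Lemma measurable_sqrt : measurable_fun setT (@Num.sqrt R).
Proof. by apply: continuous_measurable_fun; exact: sqrt_continuous. Qed.

Lemma measurable_enorm d (T : measurableType d) (f : T -> 'I_N -> R) :
  (forall i, measurable_fun setT (fun t => f t i)) ->
  measurable_fun setT (fun t => enorm (f t)).
Proof.
move=> mf; rewrite /enorm; apply: measurableT_comp; first exact: measurable_sqrt.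
by apply: measurable_sum => i; exact: measurable_funX.
Qed.

Lemma measurable_enorm_RN : measurable_fun setT (fun x : RN R N => enorm x).
Proof. by apply: measurable_enorm; exact: measurable_coord. Qed.

Definition dil (l : R) (x : RN R N) : RN R N := fun i => l * x i.

Lemma measurable_dil l : measurable_fun setT (dil l).
Proof.
apply: measurable_toRN => i; apply: measurable_funM => //; exact: measurable_coord.
Qed.

Lemma enorm_dil l (x : RN R N) : enorm (dil l x) = `|l| * enorm x.
Proof.
rewrite /enorm /dil; under eq_bigr do rewrite exprMn.
by rewrite -mulr_sumr sqrtrM ?sqr_ge0// sqrtr_sqr.
Qed.

Lemma enorm_ge0 (x : 'I_N -> R) : 0 <= enorm x.
Proof. exact: sqrtr_ge0. Qed.

Lemma coord_le_enorm (x : 'I_N -> R) i : `|x i| <= enorm x.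
Proof.
rewrite -sqrtr_sqr /enorm ler_wsqrtr// (bigD1 i)//= lerDl.
by apply: sumr_ge0 => j _; exact: sqr_ge0.
Qed.

Lemma enorm_le (x : 'I_N -> R) c : 0 <= c -> (forall i, `|x i| <= c) ->
  enorm x <= N%:R * c.
Proof.
move=> c0 xc; rewrite -[leRHS]ger0_norm ?mulr_ge0// -sqrtr_sqr ler_wsqrtr//.
apply: (@le_trans _ _ (\sum_(i < N) c ^+ 2)).
  apply: ler_sum => i _; rewrite -real_normK ?num_real//.
  by rewrite lerXn2r ?nnegrE// normr_ge0.
rewrite sumr_const card_ord exprMn -[leLHS]mulr_natl ler_wpM2r ?sqr_ge0//.
by rewrite -natrX ler_nat; case: N => // n; rewrite leq_pmulr.
Qed.

Lemma enorm_eq0 (x : 'I_N -> R) : (enorm x = 0) <-> (x = fun=> 0).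
Proof.
split=> [x0|->]; last first.
  by rewrite /enorm big1 ?sqrtr0// => i _; rewrite expr0n.
by apply/funext => i; apply/eqP; rewrite -normr_le0 -x0 coord_le_enorm.
Qed.

Lemma dil_dil l m (x : RN R N) : dil l (dil m x) = dil (l * m) x.
Proof. by apply/funext => i; rewrite /dil mulrA. Qed.

Lemma dil1 (x : RN R N) : dil 1 x = x.
Proof. by apply/funext => i; rewrite /dil mul1r. Qed.

End MeasurableMaps.

(** * Scaling of Lebesgue measure *)

Section LebesgueScaling.
Context {R : realType} {N : nat}.
Variable mu : {measure set (RN R N) -> \bar R}.
Hypothesis mu_leb : is_lebesgue mu.
Hypothesis N_gt0 : (0 < N)%N.

Lemma setI_closed_boxes : setI_closed (@boxes R N).
Proof.
move=> _ _ [a [b ->]] [c [d ->]].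
exists (fun i => Num.max (a i) (c i)), (fun i => Num.min (b i) (d i)).
apply/seteqP; split=> [x [h1 h2] i|x h].
  rewrite ge_max le_min; have /andP[h3 h4] := h1 i; have /andP[h5 h6] := h2 i.
  by rewrite h3 h4 h5 h6.
by split=> i; have := h i; rewrite ge_max le_min => /andP[/andP[h1 h2] /andP[h3 h4]];
  rewrite ?h1 ?h2 ?h3 ?h4.
Qed.

Lemma bigcup_box : \bigcup_n box (fun=> - n%:R) (fun=> n%:R) = [set: RN R N].
Proof.
apply/seteqP; split=> // x _.
exists (Num.truncn (enorm x)).+1 => // i.
by rewrite -ler_norml (le_trans (coord_le_enorm x i))// ltW// truncnS_gt.
Qed.

Lemma mu_box_fin (a b : 'I_N -> R) : (mu (box a b) < +oo)%E.
Proof.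
have [h|/existsNP[i /negP]] := pselect (forall i, a i <= b i).
  by rewrite mu_leb// ltry.
rewrite -ltNge => ba; suff -> : box a b = set0 by rewrite measure0 ltry.
apply/seteqP; split=> // x /(_ i)/andP[h1 h2].
by have := le_lt_trans (le_trans h1 h2) ba; rewrite ltxx.
Qed.

Lemma lebesgue_sigma_finite : sigma_finite setT mu.
Proof.
exists (fun n => box (fun=> - n%:R) (fun=> n%:R)); first by rewrite bigcup_box.
by move=> n; split; [exact: measurable_box|exact: mu_box_fin].
Qed.

Lemma mu_box_empty (a b : 'I_N -> R) i : b i < a i -> mu (box a b) = 0%E.
Proof.
move=> ba; suff -> : box a b = set0 by rewrite measure0.
apply/seteqP; split=> // x /(_ i)/andP[h1 h2].
by have := le_lt_trans (le_trans h1 h2) ba; rewrite ltxx.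
Qed.

(** The pushforward by the dilation and [l ^- N] times [mu] agree on boxes, which are stable under
    intersection and exhaust the space with finite mass; uniqueness of measures does the rest. *)
Lemma mu_dil (l : R) (A : set (RN R N)) : 0 < l -> measurable A ->
  mu (dil l @^-1` A) = ((l ^- N)%:E * mu A)%E.
Proof.
move=> l0 mA.
have lN0 : 0 <= l ^- N by rewrite invr_ge0 exprn_ge0// ltW.
pose m1 : {measure set (RN R N) -> \bar R} :=
  measure_function_pushforward__canonical__measure_function_Measure mu (measurable_dil l).
pose m2 : {measure set (RN R N) -> \bar R} := mscale (NngNum lN0) mu.
change (m1 A = m2 A).
apply: (@measure_unique _ R (RN R N) (@boxes R N) (fun n => box (fun=> - n%:R) (fun=> n%:R)) erefl _ _ _ m1 m2 _ _ A mA) => //.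
- exact: setI_closed_boxes.
- by move=> n; exists (fun=> - n%:R), (fun=> n%:R).
- exact: bigcup_box.
- move=> _ [a [b ->]]; change (mu (dil l @^-1` box a b) = ((l ^- N)%:E * mu (box a b))%E).
  have -> : dil l @^-1` box a b = box (fun i => l^-1 * a i) (fun i => l^-1 * b i).
    by apply/seteqP; split=> x h i; have := h i; rewrite /dil ler_pdivrMl// ler_pdivlMl.
  have [h|/existsNP[i /negP]] := pselect (forall i, a i <= b i).
    rewrite !mu_leb//; last by move=> i; rewrite ler_wpM2l// invr_ge0 ltW.
    under eq_bigr do rewrite -mulrBr.
    by rewrite big_split/= prodr_const card_ord exprVn EFinM.
  rewrite -ltNge => ba; rewrite !(@mu_box_empty _ _ i) ?mule0//.
  by rewrite ltr_pM2l ?invr_gt0.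
- move=> n; change (mu (dil l @^-1` box (fun=> - n%:R)%R (fun=> n%:R)%R) < +oo)%E.
  have -> : dil l @^-1` box (fun=> - n%:R) (fun=> n%:R) =
      box (fun=> l^-1 * - n%:R) (fun=> l^-1 * n%:R) :> set (RN R N).
    by apply/seteqP; split=> x h i; have := h i; rewrite /dil ler_pdivrMl// ler_pdivlMl.
  exact: mu_box_fin.
Qed.

Lemma ge0_integral_dil (l : R) (D : set (RN R N)) (f : RN R N -> \bar R) :
  0 < l -> measurable D -> measurable_fun setT f -> (forall x, (0 <= f x)%E) ->
  (\int[mu]_(x in dil l @^-1` D) f (dil l x) = (l ^- N)%:E * \int[mu]_(x in D) f x)%E.
Proof.
move=> l0 mD mf f0.
have lN0 : 0 <= l ^- N by rewrite invr_ge0 exprn_ge0// ltW.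
have mfD : measurable_fun D f by exact: measurable_funTS.
pose m1 : {measure set (RN R N) -> \bar R} :=
  measure_function_pushforward__canonical__measure_function_Measure mu (measurable_dil l).
rewrite -(ge0_integral_mscale mu mD (NngNum lN0))//.
rewrite -(ge0_integral_pushforward (measurable_dil l))//.
apply: (@eq_measure_integral _ _ _ _ (mscale (NngNum lN0) mu) m1) => A mA _.
by rewrite /m1/= /pushforward mu_dil.
Qed.

Lemma ge0_integral_dilT (l : R) (f : RN R N -> \bar R) :
  0 < l -> measurable_fun setT f -> (forall x, (0 <= f x)%E) ->
  (\int[mu]_x f (dil l x) = (l ^- N)%:E * \int[mu]_x f x)%E.
Proof. by move=> l0 mf f0; rewrite -ge0_integral_dil// preimage_setT. Qed.

(** The radius enters through its N-th power so that the volume is linear in [b - a] ([mu_shell]):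
    halving the interval halves the volume. *)
Definition shell (a b : R) : set (RN R N) := [set x | a <= enorm x ^+ N < b].

Lemma measurable_shell a b : measurable (shell a b).
Proof.
have -> : shell a b = [set: RN R N] `&` (fun x => enorm x ^+ N) @^-1` `[a, b[.
  by apply/seteqP; split=> [x /= h|x /=]; [split=> //=|case=> _]; rewrite in_itv.
exact: (measurable_funX N measurable_enorm_RN).
Qed.

Lemma measurable_ball0 (r : R) : measurable (Defs.ball0 r : set (RN R N)).
Proof.
have -> : Defs.ball0 r = [set: RN R N] `&` (fun x => enorm x) @^-1` `]-oo, r[.
  by apply/seteqP; split=> [x /= h|x /=]; [split=> //=|case=> _]; rewrite in_itv.
exact: measurable_enorm_RN.
Qed.

Definition omega := fine (mu (Defs.ball0 (1 : R) : set (RN R N))).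

Lemma mu_ball1_fin : (mu (Defs.ball0 (1 : R) : set (RN R N)) < +oo)%E.
Proof.
apply: (le_lt_trans _ (mu_box_fin (fun=> -1) (fun=> 1))).
apply: le_measure; rewrite ?inE; [exact: measurable_ball0|exact: measurable_box|].
by move=> x x1 i; rewrite -ler_norml (le_trans (coord_le_enorm x i))// ltW.
Qed.

Lemma omegaE : mu (Defs.ball0 (1 : R) : set (RN R N)) = omega%:E.
Proof. by rewrite fineK// ge0_fin_numE// mu_ball1_fin. Qed.

Lemma omega_gt0 : 0 < omega.
Proof.
rewrite -lte_fin -omegaE.
(* The cube [[0, c]^N] fits in the open unit ball, since its points have norm at most
   [N * c = N/(N+1) < 1]. *)
pose c : R := (N.+1%:R)^-1.
have c0 : 0 < c by rewrite invr_gt0.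
apply: (@lt_le_trans _ _ (mu (box (fun=> 0) (fun=> c)))).
  rewrite mu_leb; last by move=> _; exact: ltW.
  by rewrite lte_fin prodr_gt0// => i _; rewrite subr0.
apply: le_measure; rewrite ?inE; [exact: measurable_box|exact: measurable_ball0|].
move=> x bx; rewrite /Defs.ball0/=.
apply: (@le_lt_trans _ _ (N%:R * c)).
  apply: enorm_le; first exact: ltW.
  by move=> i; have /andP[x0 xc] := bx i; rewrite ger0_norm.
by rewrite /c ltr_pdivrMr// mul1r ltr_nat.
Qed.

Lemma mu_ball_pow t : 0 <= t -> mu [set x : RN R N | enorm x ^+ N < t] = (omega * t)%:E.
Proof.
rewrite le_eqVlt => /orP[/eqP <-|t0].
  rewrite mulr0; suff -> : [set x : RN R N | enorm x ^+ N < 0] = set0 by rewrite measure0.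
  apply/seteqP; split=> // x /=.
  by rewrite ltNge exprn_ge0// enorm_ge0.
pose l := t `^ N%:R^-1.
have l0 : 0 < l by rewrite powR_gt0.
have lN : l ^+ N = t.
  by rewrite -powR_mulrn ?ltW// -powRrM mulVf ?powRr1 ?ltW// pnatr_eq0 -lt0n.
have -> : [set x : RN R N | enorm x ^+ N < t] = dil l^-1 @^-1` Defs.ball0 1.
  apply/seteqP; split=> x; rewrite /Defs.ball0/= enorm_dil gtr0_norm ?invr_gt0//;
  by rewrite ltr_pdivrMl// mulr1 -lN ltr_pXn2r ?nnegrE ?enorm_ge0 ?(ltW l0).
rewrite mu_dil ?invr_gt0//; last exact: measurable_ball0.
by rewrite omegaE exprVn invrK lN -EFinM mulrC.
Qed.

Lemma mu_shell a b : 0 <= a -> a <= b -> mu (shell a b) = (omega * (b - a))%:E.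
Proof.
move=> a0 ab.
have -> : shell a b = [set x : RN R N | enorm x ^+ N < b] `\` [set x : RN R N | enorm x ^+ N < a].
  apply/seteqP; split=> x; rewrite /shell/=.
    by move=> /andP[ax xb]; split=> //; apply/negP; rewrite -leNgt.
  by move=> [-> /negP]; rewrite -leNgt => ->.
have mS c : measurable [set x : RN R N | enorm x ^+ N < c].
  have -> : [set x : RN R N | enorm x ^+ N < c] =
     [set: RN R N] `&` (fun x => enorm x ^+ N) @^-1` `]-oo, c[.
    by apply/seteqP; split=> [x /= h|x /=]; [split=> //=|case=> _]; rewrite in_itv.
  exact: (measurable_funX N measurable_enorm_RN).
pose B c : set (RN R N) := [set x | enorm x ^+ N < c].
have mB c : 0 <= c -> mu (B c) = (omega * c)%:E by exact: mu_ball_pow.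
have Bfin : (mu (B b) < +oo)%E by rewrite mB ?ltry// (le_trans a0).
transitivity (mu (B b) - mu (B b `&` B a))%E; first exact: measureD.
rewrite setIidr; last by move=> x; rewrite /B/= => /lt_le_trans; exact.
by rewrite !mB//; [rewrite -EFinB mulrBr|exact: le_trans ab].
Qed.

Lemma mu_zero : mu [set (fun=> 0) : RN R N] = 0%E.
Proof.
have -> : [set (fun=> 0) : RN R N] = box (fun=> 0) (fun=> 0).
  apply/seteqP; split=> [x -> i|x h]; first by rewrite lexx.
  by apply/funext => i; apply/eqP; rewrite eq_le andbC; exact: h.
rewrite mu_leb//; case: N N_gt0 => // n _.
by rewrite big_ord_recl subr0 mul0r.
Qed.

End LebesgueScaling.

(** * The Gagliardo kernel along dilations *)

Section Kernel.
Context {R : realType} {N : nat}.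
Variable mu : {sigma_finite_measure set (RN R N) -> \bar R}.
Hypothesis mu_leb : is_lebesgue mu.
Hypothesis N_gt0 : (0 < N)%N.
Variable s : R.
Hypothesis s_gt0 : 0 < s.

Let P : R := N%:R + 2 * s.

Definition kern (u : RN R N -> R) (x y : RN R N) : R :=
  `|u x - u y| ^+ 2 / (enorm (fun i => x i - y i) `^ (N%:R + 2 * s)).

Definition gagk (u : RN R N -> R) (x : RN R N) : \bar R :=
  (\int[mu]_y (kern u x y)%:E)%E.

Definition gag (u : RN R N -> R) : \bar R := (\int[mu]_x gagk u x)%E.

Lemma kern_ge0 u x y : 0 <= kern u x y.
Proof. by rewrite /kern divr_ge0// ?exprn_ge0// powR_ge0. Qed.

Lemma gagk_ge0 u x : (0 <= gagk u x)%E.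
Proof. by apply: integral_ge0 => y _; rewrite lee_fin kern_ge0. Qed.

Lemma gag_ge0 u : (0 <= gag u)%E.
Proof. by apply: integral_ge0 => y _; exact: gagk_ge0. Qed.

Lemma measurable_kern u : measurable_fun setT u ->
  measurable_fun setT (fun z : RN R N * RN R N => (kern u z.1 z.2)%:E).
Proof.
move=> mu_; apply/measurable_EFinP.
rewrite (_ : (fun z => _) = (fun z : RN R N * RN R N => `|u z.1 - u z.2| ^+ 2 *
    enorm (fun i => z.1 i - z.2 i) `^ (- (N%:R + 2 * s)))); last first.
  by apply/funext => z; rewrite powRN.
apply: measurable_funM.
  apply: measurable_funX; apply: measurableT_comp; first exact: normr_measurable.
  by apply: measurable_funB; apply: measurableT_comp.
apply: (@measurableT_comp _ _ _ _ _ _ (@powR R ^~ (- (N%:R + 2 * s))) _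
  (fun z : RN R N * RN R N => enorm (fun i => z.1 i - z.2 i))).
  exact: measurable_powR.
apply: measurable_enorm => i; apply: measurable_funB.
  exact: (measurableT_comp (measurable_coord i)).
exact: (measurableT_comp (measurable_coord i)).
Qed.

Lemma measurable_kern_l u x : measurable_fun setT u ->
  measurable_fun setT (fun y => (kern u x y)%:E).
Proof.
move=> mu_.
exact: (measurable_fun_pair2 x (measurable_kern mu_)).
Qed.

Lemma measurable_gagk u : measurable_fun setT u -> measurable_fun setT (gagk u).
Proof.
move=> mu_; apply: (measurable_fun_fubini_tonelli_F _ (measurable_kern mu_)).
by move=> z; rewrite lee_fin kern_ge0.
Qed.

Lemma sqr_diff_le_kern u x z rho : enorm (fun i => x i - z i) <= rho ->
  (u x - u z) ^+ 2 <= rho `^ P * kern u x z.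
Proof.
(* On the diagonal the division is by 0 and yields 0, so this case is settled by [x = z] instead of
   by clearing the denominator. *)
move=> xz; have [e0|e0] := eqVneq (enorm (fun i => x i - z i)) 0.
  have -> : x = z.
    move/enorm_eq0 : e0 => e0; apply/funext => i; apply/eqP.
    by rewrite -subr_eq0; move/(congr1 (fun f => f i)) : e0 => ->.
  by rewrite subrr expr0n mulr_ge0 ?powR_ge0 ?kern_ge0.
have epos : 0 < enorm (fun i => x i - z i) by rewrite lt_neqAle eq_sym e0 enorm_ge0.
rewrite /kern real_normK ?num_real// mulrA ler_pdivlMr ?powR_gt0// mulrC.
rewrite ler_wpM2r ?sqr_ge0//; apply: ge0_ler_powR => //.
- by rewrite addr_ge0// mulr_ge0// ltW.
- by rewrite nnegrE ltW.
- by rewrite nnegrE (le_trans (ltW epos)).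
Qed.

(* Average [(u x - u (l x))^2 <= 2 (u x - u z)^2 + 2 (u z - u (l x))^2] over
   [z] in the cube of half-width [h] centered at [x]. *)
Lemma sqr_diff_dil (u : RN R N -> R) (x : RN R N) (b l h : R) : measurable_fun setT u ->
  enorm x <= b -> `|l - 1| <= h -> 0 < h ->
  (((u x - u (dil l x)) ^+ 2)%:E <=
   (2 * (N%:R * (1 + b)) `^ P / 2 ^+ N * h `^ (2 * s))%:E *
     (gagk u x + gagk u (dil l x)))%E.
Proof.
move=> mu_ xb lh h0.
have b0 : 0 <= b by rewrite (le_trans (enorm_ge0 x)).
(* For [z] in the cube, the coordinates of [x - z] are at most [h] and those of [l x - z] at most
   [(1 + b) h], so both norms are at most [L * h]. Dividing [(L h) ^ P] by the volume [(2 h) ^ N]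
   leaves the power [h ^ (2s)]. *)
pose L := N%:R * (1 + b); have L0 : 0 < L by rewrite mulr_gt0 ?ltr0n// ltr_pwDl.
pose Q : set (RN R N) := box (fun i => x i - h) (fun i => x i + h).
have mQ : measurable Q by exact: measurable_box.
have muQ : mu Q = ((2 * h) ^+ N)%:E.
  rewrite /Q mu_leb; last by move=> i; lra.
  rewrite (eq_bigr (fun=> 2 * h)); last by move=> i _; ring.
  by rewrite prodr_const card_ord.
pose c := 2 * (L * h) `^ P.
have c0 : 0 <= c by rewrite mulr_ge0// powR_ge0.
have step : (((u x - u (dil l x)) ^+ 2)%:E * mu Q <=
    c%:E * (gagk u x + gagk u (dil l x)))%E.
  rewrite -integral_cst// /gagk -ge0_integralD//; last 4 first.
  - by move=> z _; rewrite lee_fin kern_ge0.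
  - exact: measurable_kern_l.
  - by move=> z _; rewrite lee_fin kern_ge0.
  - exact: measurable_kern_l.
  have mD : measurable_fun setT (fun z => (kern u x z)%:E + (kern u (dil l x) z)%:E)%E.
    by apply: emeasurable_funD; exact: measurable_kern_l.
  rewrite -ge0_integralZl_EFin//; last first.
    by move=> z _; rewrite adde_ge0// lee_fin kern_ge0.
  apply: (@le_trans _ _ (\int[mu]_(z in Q)
     (c%:E * ((kern u x z)%:E + (kern u (dil l x) z)%:E)))%E).
    apply: ge0_le_integral => //.
    - by move=> z _; rewrite lee_fin sqr_ge0.
    - by apply: measurable_funTS; exact: measurable_funeM.
    move=> z Qz; rewrite -EFinD -EFinM lee_fin.
    have xz i : `|x i - z i| <= h.
      by rewrite ler_norml; have /andP[? ?] := Qz i; apply/andP; split; lra.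
    have h1 : (u x - u z) ^+ 2 <= (L * h) `^ P * kern u x z.
      apply: sqr_diff_le_kern; rewrite /L.
      apply: (@le_trans _ _ (N%:R * h)); first by apply: enorm_le => //; exact: ltW.
      by rewrite -mulrA ler_wpM2l// ler_peMl ?(ltW h0)// lerDl.
    have h2 : (u (dil l x) - u z) ^+ 2 <= (L * h) `^ P * kern u (dil l x) z.
      apply: sqr_diff_le_kern; rewrite /L -mulrA.
      apply: enorm_le => [|i]; first by rewrite mulr_ge0 ?(ltW h0)// addr_ge0.
      have -> : dil l x i - z i = (l - 1) * x i + (x i - z i).
        by rewrite /dil; ring.
      rewrite (le_trans (ler_normD _ _))// normrM mulrDl mul1r addrC lerD//.
      rewrite mulrC ler_pM// (le_trans (coord_le_enorm x i))//.
    have : (u x - u (dil l x)) ^+ 2 <=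
        2 * (u x - u z) ^+ 2 + 2 * (u (dil l x) - u z) ^+ 2.
      have := sqr_ge0 ((u x - u z) + (u (dil l x) - u z)); nra.
    by rewrite /c; nra.
  apply: ge0_subset_integral => //; first exact: measurable_funeM.
  by move=> z _; rewrite mule_ge0// adde_ge0// lee_fin kern_ge0.
have hN : 0 < (2 * h) ^+ N by rewrite exprn_gt0// mulr_gt0.
move: step; rewrite muQ -lee_pdivlMr// => /le_trans; apply.
rewrite muleAC -EFinM; apply: lee_pmul => //.
- by rewrite lee_fin divr_ge0// ltW.
- by rewrite adde_ge0// gagk_ge0.
have hP : h `^ P = h ^+ N * h `^ (2 * s).
  rewrite /P powRD ?powR_mulrn ?(ltW h0)//.
  by apply/implyP => _; rewrite gt_eqF.
rewrite lee_fin /c powRM ?(ltW L0) ?(ltW h0)// hP exprMn.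
have hN' : h ^+ N != 0 by rewrite expf_neq0// gt_eqF.
have N2 : (2 : R) ^+ N != 0 by rewrite expf_neq0.
rewrite le_eqVlt; apply/orP; left; apply/eqP; rewrite /L; field.
by rewrite hN' N2.
Qed.

End Kernel.

(** * Energy of a spherical shell *)

Section TonelliOnSet.
Context {d1 d2 : measure_display} {T1 : measurableType d1} {T2 : measurableType d2}
  {R : realType}.
Variables (m1 : {sigma_finite_measure set T1 -> \bar R})
  (m2 : {sigma_finite_measure set T2 -> \bar R}).
Variables (f : T1 * T2 -> \bar R) (D : set T2).
Hypotheses (mD : measurable D) (mf : measurable_fun setT f) (f0 : forall z, (0 <= f z)%E).

(** The indicator of [D] is absorbed into the integrand, so that Tonelli on the full product
    applies. *)
Let fD (z : T1 * T2) : \bar R := (f z * (\1_D z.2)%:E)%E.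

Let mfD : measurable_fun setT fD.
Proof.
apply: emeasurable_funM => //; apply/measurable_EFinP.
by apply: (measurableT_comp (measurable_indic mD)).
Qed.

Let fD0 z : (0 <= fD z)%E.
Proof. by rewrite mule_ge0// lee_fin. Qed.

Let fDE x : (\int[m2]_(y in D) f (x, y) = \int[m2]_y fD (x, y))%E.
Proof. by rewrite integral_mkcond epatch_indic. Qed.

Lemma measurable_integral_in : measurable_fun setT (fun x => (\int[m2]_(y in D) f (x, y))%E).
Proof.
rewrite (_ : (fun x => _) = fubini_F m2 fD); last by apply/funext => x; rewrite fDE.
exact: measurable_fun_fubini_tonelli_F.
Qed.

Lemma tonelli_in :
  (\int[m1]_x \int[m2]_(y in D) f (x, y) = \int[m2]_(y in D) \int[m1]_x f (x, y))%E.
Proof.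
under eq_integral do rewrite fDE.
rewrite (fubini_tonelli _ mfD fD0) [RHS]integral_mkcond epatch_indic.
apply: eq_integral => y _; rewrite /fD/= ge0_integralZr// ?lee_fin//.
exact: measurable_fun_pair1.
Qed.

End TonelliOnSet.

Section ShellEnergy.
Context {R : realType} {N : nat}.
Variable mu : {sigma_finite_measure set (RN R N) -> \bar R}.
Hypothesis mu_leb : is_lebesgue mu.
Hypothesis N_gt0 : (0 < N)%N.
Variable s : R.
Hypothesis s_gt0 : 0 < s.

(** Origin of the factors: [b] bounds the Jacobian [|x| ^ N] of the substitution, the next factor is
    the constant of [sqr_diff_dil] without its power of [h], [1 + b] collects the terms [k(x)] and
    [k(|y| x)], the latter paying a Jacobian at most [b], and [2 * omega] comes from the volume of
    the set of ratios. *)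
Definition shellC (b : R) : R :=
  b * (2 * (N%:R * (1 + b)) `^ (N%:R + 2 * s) / 2 ^+ N) * (1 + b) * (2 * omega mu).

Lemma shellC_ge0 b : 0 <= b -> 0 <= shellC b.
Proof.
move=> b0; rewrite /shellC !mulr_ge0 ?powR_ge0 ?addr_ge0 ?invr_ge0//.
by rewrite ltW// omega_gt0.
Qed.

(* For fixed [x], substitute [y = |x| y']: radiality turns [u (|x| y')] into
   [u (|y'| x)], so that [sqr_diff_dil] applies and only dilations are needed. *)
Lemma shell_energy_le (u : RN R N -> R) (a c b : R) :
  measurable_fun setT u -> radial u -> 1 <= a -> a < c -> c <= b ->
  (\int[mu]_(x in shell a c) \int[mu]_(y in shell a c) ((u x - u y) ^+ 2)%:E <=
   (shellC b * (c - a) `^ (2 * s) * (c - a))%:E *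
     \int[mu]_(x in shell a c) gagk mu s u x)%E.
Proof.
move=> mu_ ru a1 ac cb.
have b1 : 1 <= b by lra.
pose h := c - a; have h0 : 0 < h by rewrite /h; lra.
pose S : set (RN R N) := shell a c.
have mS : measurable S by exact: measurable_shell.
pose D : R := 2 * (N%:R * (1 + b)) `^ (N%:R + 2 * s) / 2 ^+ N * h `^ (2 * s).
have D0 : 0 <= D.
  by rewrite /D !mulr_ge0 ?powR_ge0 ?invr_ge0.
pose k := gagk mu s u.
have mk : measurable_fun setT k by exact: measurable_gagk.
have k0 x : (0 <= k x)%E by exact: gagk_ge0.
(* Both points lie in the shell, so the energy density may be cut off to [S]; after undoing the
   dilation only the energy of the shell itself remains. *)
pose kS := k \_ S.
have mkS : measurable_fun setT kS.
  by apply/(measurable_restrictT _ mS); exact: measurable_funTS.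
have kS0 x : (0 <= kS x)%E by rewrite /kS patchE; case: ifP.
(* Contains every [y] with [x] and [|x| y] both in the shell: [|x|^N |y|^N] and [|x|^N] differ by
   less than [h] and [|x|^N >= 1], so [|y|^N] is within [h] of 1. The bound [b^-1] keeps the
   Jacobian [|y|^-N] of the later dilation below [b] when [h] is large. *)
pose Y : set (RN R N) := shell (Num.max (1 - h) b^-1) (1 + h).
have mY : measurable Y by exact: measurable_shell.
have b0 : 0 < b by lra.
have vb : b^-1 <= 1 by rewrite invf_le1.
have muY : (mu Y <= (2 * omega mu * h)%:E)%E.
  rewrite mu_shell//; last 2 first.
  - by rewrite le_max invr_ge0 (ltW b0) orbT.
  - by rewrite ge_max; apply/andP; split; lra.
  have : 1 - h <= Num.max (1 - h) b^-1 by rewrite le_max lexx.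
  rewrite lee_fin (mulrC 2) -mulrA ler_pM2l ?omega_gt0//; lra.
pose G (z : RN R N * RN R N) : \bar R := kS (dil (enorm z.2) z.1).
have mG : measurable_fun setT G.
  apply: (@measurableT_comp _ _ _ _ _ _ kS _ (fun z : RN R N * RN R N => dil (enorm z.2) z.1)) => //.
  apply: measurable_toRN => i; apply: measurable_funM.
    by apply: (measurableT_comp measurable_enorm_RN).
  by apply: (measurableT_comp (measurable_coord i)).
have G0 z : (0 <= G z)%E by exact: kS0.
have mG2 x : measurable_fun setT (fun y => G (x, y)) by exact: (measurable_fun_pair2 x mG).
have mkG x : measurable_fun setT (fun y => k x + G (x, y))%E.
  by apply: emeasurable_funD; [exact: measurable_cst|exact: mG2].
have inner x : S x ->
  (\int[mu]_(y in S) ((u x - u y) ^+ 2)%:E <=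
   (b * D)%:E * (k x * mu Y + \int[mu]_(y in Y) G (x, y)))%E.
  move=> Sx; have [Sx1 Sx2] := andP Sx.
  pose r := enorm x.
  have r0 : 0 < r.
    rewrite lt_neqAle enorm_ge0 andbT eq_sym; apply/eqP => r0.
    by move: Sx1; rewrite -/r r0 expr0n gtn_eqF//=; lra.
  have mux : measurable_fun setT (fun y => ((u x - u y) ^+ 2)%:E).
    by apply/measurable_EFinP; apply: measurable_funX; exact: measurable_funB.
  have ux0 y : (0 <= ((u x - u y) ^+ 2)%:E)%E by rewrite lee_fin sqr_ge0.
  have -> : (\int[mu]_(y in S) ((u x - u y) ^+ 2)%:E =
     (r ^+ N)%:E * \int[mu]_(y in dil r @^-1` S) ((u x - u (dil r y)) ^+ 2)%:E)%E.
    rewrite (@ge0_integral_dil _ _ mu mu_leb r S (fun y => ((u x - u y) ^+ 2)%:E))//.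
    by rewrite muleA -EFinM divff ?mul1e// expf_neq0// gt_eqF.
  rewrite EFinM -muleA; apply: lee_pmul.
  - by rewrite lee_fin exprn_ge0// ltW.
  - by apply: integral_ge0 => y _; rewrite lee_fin sqr_ge0.
  - by rewrite lee_fin; apply: le_trans cb; exact: ltW.
  have key y : S (dil r y) -> Y y /\
     (((u x - u (dil r y)) ^+ 2)%:E <= D%:E * (k x + G (x, y)))%E.
    move=> Sy; pose t := enorm y.
    have t0 : 0 <= t by exact: enorm_ge0.
    have erx : enorm (dil r y) = enorm (dil t x).
      by rewrite !enorm_dil /r /t mulrC !ger0_norm ?enorm_ge0.
    have [Sy1 Sy2] : a <= r ^+ N * t ^+ N /\ r ^+ N * t ^+ N < c.
      by move: Sy; rewrite /S/shell/= enorm_dil ger0_norm ?(ltW r0)// exprMn => /andP[].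
    have rN : 0 < r ^+ N by exact: exprn_gt0.
    have [tN1 tN2] : 1 - h < t ^+ N /\ t ^+ N < 1 + h.
      have r1 : 1 <= r ^+ N := le_trans a1 Sx1.
      move: Sx2 Sy1 Sy2 Sx1 h0; rewrite -/r; set A := r ^+ N; set B := t ^+ N => *.
      have hc : c = a + h by rewrite /h addrC subrK.
      have h2 : h <= A * h by rewrite ler_peMl// ltW.
      split; rewrite ltNge; apply/negP => hB.
        have := ler_wpM2l (ltW rN) hB; rewrite -/A; lra.
      have := ler_wpM2l (ltW rN) hB; rewrite -/A; lra.
    have bt : b^-1 <= t ^+ N.
      rewrite -[leLHS]mul1r ler_pdivrMr//.
      have := mulr_ge0 (ltW rN) (exprn_ge0 N t0); nra.
    split; first by rewrite /Y/shell/= ge_max (ltW tN1) bt tN2.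
    (* [t] lies between [1] and [t ^+ N], so the bound on [t ^+ N] passes to [t]. *)
    have tdist : `|t - 1| <= h.
      have [t1|t1] := leP 1 t.
        rewrite ger0_norm ?subr_ge0//.
        have : t <= t ^+ N by rewrite -{1}[t]expr1 ler_weXn2l. lra.
      rewrite ltr0_norm ?subr_lt0//.
      have : t ^+ N <= t by rewrite -{2}[t]expr1 ler_wiXn2l// ltW. lra.
    have -> : u (dil r y) = u (dil t x) by exact: ru.
    have -> : G (x, y) = k (dil t x).
      rewrite /G/= /kS patchE mem_set//.
      by move: Sy; rewrite /S/shell/= -erx.
    rewrite /D; apply: sqr_diff_dil => //.
    rewrite (@le_trans _ _ (r ^+ N))//; last by apply: le_trans cb; exact: ltW.
    rewrite -{1}[enorm x]expr1 ler_weXn2l//.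
    rewrite leNgt; apply/negP => r1.
    have : r ^+ N < 1 by rewrite /r exprn_ilt1 ?enorm_ge0 // -lt0n.
    by move: Sx1; rewrite -/r; lra.
  have mH : measurable_fun setT (fun y => D%:E * (k x + G (x, y)))%E.
    by apply: measurable_funeM; exact: mkG.
  have mrS : measurable (dil r @^-1` S).
    by rewrite -[X in measurable X]setTI; exact: measurable_dil.
  apply: (@le_trans _ _ (\int[mu]_(y in dil r @^-1` S) (D%:E * (k x + G (x, y))))%E).
    apply: ge0_le_integral => //.
    - apply: measurable_funTS; apply: (measurableT_comp mux); exact: measurable_dil.
    - exact: measurable_funTS.
    - by move=> y /key[].
  apply: (@le_trans _ _ (\int[mu]_(y in Y) (D%:E * (k x + G (x, y))))%E).
    apply: ge0_subset_integral => //.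
    - exact: measurable_funTS.
    - by move=> y _; rewrite mule_ge0// adde_ge0.
    - by move=> y /key[].
  rewrite ge0_integralZl_EFin//; last 2 first.
  - by move=> y _; rewrite adde_ge0.
  - by apply: measurable_funTS; exact: mkG.
  have mGY : measurable_fun Y (fun y => G (x, y)) by apply: measurable_funTS; exact: mG2.
  rewrite (ge0_integralD mu mY (fun y _ => k0 x) (measurable_cst (k x)) (fun y _ => G0 (x, y)) mGY).
  by rewrite (integral_cst mu mY (k x)).
have mint : measurable_fun setT (fun x => \int[mu]_(y in Y) G (x, y))%E.
  exact: (measurable_integral_in _ mY mG G0).
have int0 x : (0 <= \int[mu]_(y in Y) G (x, y))%E by exact: integral_ge0.
apply: (@le_trans _ _ (\int[mu]_(x in S) ((b * D)%:E *
    (k x * mu Y + \int[mu]_(y in Y) G (x, y))))%E).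
  apply: ge0_le_integral => //.
  - by move=> x _; apply: integral_ge0 => y _; rewrite lee_fin sqr_ge0.
  - apply: measurable_funTS.
    apply: (@measurable_integral_in _ _ _ _ _ mu (fun z => ((u z.1 - u z.2) ^+ 2)%:E)) => //.
      apply/measurable_EFinP; apply: measurable_funX.
      by apply: measurable_funB; apply: measurableT_comp.
    by move=> z; rewrite lee_fin sqr_ge0.
  - apply: measurable_funTS; apply: measurable_funeM; apply: emeasurable_funD => //.
    by apply: emeasurable_funM.
have bD0 : 0 <= b * D by rewrite mulr_ge0// ltW.
rewrite ge0_integralZl_EFin//; last 2 first.
- by move=> x _; rewrite adde_ge0// mule_ge0.
- apply: measurable_funTS; apply: emeasurable_funD => //.
  by apply: emeasurable_funM.
rewrite ge0_integralD//; last 3 first.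
- by move=> x _; rewrite mule_ge0.
- by apply: measurable_funTS; apply: emeasurable_funM.
- exact: measurable_funTS.
rewrite ge0_integralZr//; last exact: measurable_funTS.
pose I := (\int[mu]_(x in S) k x)%E.
have I0 : (0 <= I)%E by exact: integral_ge0.
(* Integrate in [x] first: for fixed [y] the map [x -> |y| x] is a dilation, costing [|y|^-N <= b],
   and the cutoff [kS] gives back the energy [I]. *)
have second : (\int[mu]_(x in S) \int[mu]_(y in Y) G (x, y) <= (b * (2 * omega mu * h))%:E * I)%E.
  apply: (@le_trans _ _ (\int[mu]_x \int[mu]_(y in Y) G (x, y))%E).
    exact: ge0_subset_integral.
  rewrite tonelli_in//.
  apply: (@le_trans _ _ (\int[mu]_(y in Y) (cst (b%:E * I) y))%E).
    apply: ge0_le_integral; first exact: mY.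
    - by move=> y _; apply: integral_ge0 => x _; exact: G0.
    - apply: measurable_funTS.
      exact: (@measurable_fun_fubini_tonelli_G _ _ _ _ _ mu G mG G0).
    - exact: measurable_cst.
    - move=> y Yy; pose t := enorm y.
      have bt : b^-1 <= t ^+ N by move: Yy => /andP[]; rewrite ge_max => /andP[].
      have tN : 0 < t ^+ N by rewrite (lt_le_trans _ bt)// invr_gt0.
      have t0 : 0 < t.
        rewrite lt_neqAle enorm_ge0 andbT eq_sym; apply/eqP => t0.
        by move: tN; rewrite t0 expr0n gtn_eqF// ltxx.
      rewrite /G/= (@ge0_integral_dilT _ _ mu mu_leb t kS)//.
      rewrite /kS -integral_mkcond lee_wpmul2r// lee_fin.
      by rewrite -[leRHS]invrK lef_pV2// posrE invr_gt0.
  rewrite integral_cst// EFinM -!muleA lee_wpmul2l ?lee_fin ?(ltW b0)//.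
  by rewrite muleC lee_wpmul2r.
rewrite -/I.
have first : (I * mu Y <= (2 * omega mu * h)%:E * I)%E by rewrite muleC lee_wpmul2r.
apply: (@le_trans _ _ ((b * D)%:E *
   ((2 * omega mu * h)%:E * I + (b * (2 * omega mu * h))%:E * I))%E).
  by rewrite lee_wpmul2l ?lee_fin// leeD.
have om0 : 0 <= omega mu by rewrite ltW// omega_gt0.
rewrite -ge0_muleDl ?lee_fin ?mulr_ge0 ?(ltW b0) ?(ltW h0)//.
rewrite muleA -EFinD -EFinM lee_wpmul2r// lee_fin /shellC /D -/h.
rewrite le_eqVlt; apply/orP; left; apply/eqP.
by ring.
Qed.

End ShellEnergy.

(** * Null integrals, averages and geometric bounds *)

Section IntegralFacts.
Context {d : measure_display} {T : measurableType d} {R : realType}.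
Variable mu : {measure set T -> \bar R}.

Lemma ge0_integral_eq0_ae (S : set T) (f : T -> \bar R) :
  measurable S -> measurable_fun S f -> (forall x, S x -> (0 <= f x)%E) ->
  (\int[mu]_(x in S) f x <= 0)%E -> {ae mu, forall x, S x -> f x = 0%E}.
Proof.
move=> mS mf f0 If.
have : ae_eq mu S f (cst 0%E).
  apply/ae_eq_integral_abs => //.
  apply/eqP; rewrite eq_le; apply/andP; split.
    rewrite (le_trans _ If)// le_eqVlt; apply/orP; left; apply/eqP.
    by apply: eq_integral => x /[!inE] Sx; rewrite gee0_abs// f0.
  by apply: integral_ge0 => x _; exact: abse_ge0.
by [].
Qed.

(** Otherwise [f - c] would be positive on [S] with integral at most 0, making [S] a null set. *)
Lemma exists_le_average (S : set T) (f : T -> \bar R) (c : R) :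
  measurable S -> (0 < mu S)%E -> (mu S < +oo)%E -> measurable_fun S f ->
  0 <= c -> (\int[mu]_(x in S) f x <= c%:E * mu S)%E ->
  exists2 x, S x & (f x <= c%:E)%E.
Proof.
move=> mS S0 Soo mf c0 If; apply: contrapT => h.
have fc x : S x -> (c%:E < f x)%E.
  by move=> Sx; rewrite ltNge; apply/negP => fx; apply: h; exists x.
have mg : measurable_fun S (fun x => f x - c%:E)%E.
  by apply: emeasurable_funB => //; exact: measurable_cst.
have g0 x : S x -> (0 <= f x - c%:E)%E by move=> Sx; rewrite sube_ge0// ltW// fc.
have muSf : mu S \is a fin_num by rewrite ge0_fin_numE.
have : (\int[mu]_(x in S) (f x - c%:E) <= 0)%E.
  have E : (\int[mu]_(x in S) f x = \int[mu]_(x in S) (f x - c%:E) + c%:E * mu S)%E.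
    rewrite -(integral_cst mu mS c%:E) -ge0_integralD//.
    by apply: eq_integral => x _; rewrite subeK.
  by move: If; rewrite E -leeBrDr ?subee ?fin_numM.
move/(ge0_integral_eq0_ae mS mg g0) => [Z [mZ Z0 hZ]].
have : (mu S <= mu Z)%E.
  apply: le_measure; rewrite ?inE// => x Sx; apply: hZ => /= /(_ Sx) fx0.
  by have := fc _ Sx; rewrite -sube_gt0 fx0 ltxx.
by rewrite Z0 leNgt S0.
Qed.

Lemma le_geometric_le0 (X K t : R) : 0 <= t < 1 ->
  (forall l : nat, X <= K * t ^+ l) -> X <= 0.
Proof.
move=> /andP[t0 t1] h.
have c : (fun l : nat => K * t ^+ l) @ \oo --> 0.
  by apply: cvg_geometric; rewrite ger0_norm.
rewrite -(cvg_lim _ c)//; apply: limr_ge; first by apply/cvg_ex; exists 0.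
by apply: nearW.
Qed.

End IntegralFacts.

(** * Oscillation on shells *)

Section Oscillation.
Context {R : realType} {N : nat}.
Variable mu : {sigma_finite_measure set (RN R N) -> \bar R}.
Hypothesis mu_leb : is_lebesgue mu.
Hypothesis N_gt0 : (0 < N)%N.
Variable s : R.
Hypothesis s_gt2 : 2^-1 < s.
Variable b : R.
Hypothesis b_ge1 : 1 <= b.

Let s_gt0 : 0 < s. Proof. exact: lt_trans s_gt2. Qed.
Let sg : R := s - 2^-1.
Let sg_gt0 : 0 < sg. Proof. by rewrite subr_gt0. Qed.
Let om := omega mu.
Let om_gt0 : 0 < om. Proof. exact: omega_gt0. Qed.

Definition repC : R := shellC mu s b / omega mu.

Lemma repC_ge0 : 0 <= repC.
Proof.
by rewrite divr_ge0 ?(ltW om_gt0)// shellC_ge0// (le_trans _ b_ge1).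
Qed.

(** Read off from [rep_half]: two deviations, each weighted by 2, give [(A' - A)^2 * (om h / 2) <= 4
    repC h^(2s) g^2], hence the factor 8. *)
Let kap : R := Num.sqrt (8 * repC / om).

(** Sum of the jumps [kap * 2 ^ (- j sg)] over all successive halvings; it is finite because
    [sg = s - 1/2] is positive. *)
Definition oscC : R := kap / (1 - 2 `^ (- sg)).

Lemma powR2N_lt1 (t : R) : 0 < t -> 2 `^ (- t) < 1 :> R.
Proof.
move=> t0; rewrite powRN invf_lt1 ?powR_gt0//.
by rewrite /powR pnatr_eq0/= expR_gt1 mulr_gt0// ln_gt0// ltr1n.
Qed.

Lemma oscC_ge0 : 0 <= oscC.
Proof. by rewrite divr_ge0 ?sqrtr_ge0// subr_ge0 ltW// powR2N_lt1. Qed.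

Variable u : RN R N -> R.
Hypotheses (mu_ : measurable_fun setT u) (ru : radial u).
Variable g : R.
Hypotheses (g_ge0 : 0 <= g) (gag_le : (gag mu s u <= (g ^+ 2)%:E)%E).

Let E (a c : R) : \bar R := (\int[mu]_(x in shell a c) gagk mu s u x)%E.
Let dev (A : R) (x : RN R N) : R := (u x - A) ^+ 2.

Let mk : measurable_fun setT (gagk mu s u). Proof. exact: measurable_gagk. Qed.
Let mdev A : measurable_fun setT (dev A).
Proof. by apply: measurable_funX; exact: measurable_funB. Qed.

Let E_ge0 a c : (0 <= E a c)%E.
Proof. by apply: integral_ge0 => x _; exact: gagk_ge0. Qed.

Let E_le a c : (E a c <= (g ^+ 2)%:E)%E.
Proof.
apply: le_trans gag_le; apply: ge0_subset_integral => //; first exact: measurable_shell.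
by move=> x _; exact: gagk_ge0.
Qed.

Let E_fin a c : E a c \is a fin_num.
Proof. by rewrite ge0_fin_numE// (le_lt_trans (E_le a c))// ltry. Qed.

(** [A] is an admissible value for [u] on the shell. Dividing the double integral of
    [shell_energy_le] by the volume [omega * (c - a)] gives this bound. *)
Let rep (a c A : R) : Prop :=
  (\int[mu]_(x in shell a c) (dev A x)%:E <= (repC * (c - a) `^ (2 * s))%:E * E a c)%E.

(** The representative is a value [u y], taken at a point [y] of the shell where the inner integral
    does not exceed its mean. *)
Let exists_rep a c : 1 <= a -> a < c -> c <= b -> exists A, rep a c A.
Proof.
move=> a1 ac cb.
have a0 : 0 <= a by rewrite (le_trans _ a1).
have mS : measurable (shell a c : set (RN R N)) by exact: measurable_shell.
have muS := mu_shell mu_leb N_gt0 a0 (ltW ac); rewrite -/om in muS.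
have h0 : 0 < c - a by rewrite subr_gt0.
pose f (z : RN R N * RN R N) : \bar R := ((u z.1 - u z.2) ^+ 2)%:E.
have mf : measurable_fun setT f.
  apply/measurable_EFinP; apply: measurable_funX.
  by apply: measurable_funB; apply: measurableT_comp.
have f0 z : (0 <= f z)%E by rewrite lee_fin sqr_ge0.
have mF : measurable_fun (shell a c) (fun x => \int[mu]_(y in shell a c) f (x, y))%E.
  by apply: measurable_funTS; exact: (measurable_integral_in _ mS mf f0).
have [] := @exists_le_average _ _ _ mu (shell a c) (fun x => \int[mu]_(y in shell a c) f (x, y))%E
  (repC * (c - a) `^ (2 * s) * fine (E a c)) mS _ _ mF.
- by rewrite muS lte_fin mulr_gt0.
- by rewrite muS ltry.
- apply: mulr_ge0; last exact: fine_ge0.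
  by apply: mulr_ge0; [exact: repC_ge0|exact: powR_ge0].
- apply: (le_trans (shell_energy_le mu_leb N_gt0 s_gt0 mu_ ru a1 ac cb)).
  rewrite muS -[X in (_ * X)%E](fineK (E_fin a c)) -!EFinM lee_fin /repC -/om.
  rewrite le_eqVlt; apply/orP; left; apply/eqP; field.
  by rewrite gt_eqF.
move=> y _ hy; exists (u y); rewrite /rep -(fineK (E_fin a c)) -EFinM.
apply: le_trans hy; rewrite le_eqVlt; apply/orP; left; apply/eqP.
by apply: eq_integral => x _; rewrite /f /dev/= -sqrrN opprB.
Qed.

Let kapE : kap ^+ 2 = 8 * repC / om.
Proof.
by rewrite sqr_sqrtr//; apply: divr_ge0; [apply: mulr_ge0 => //; exact: repC_ge0|exact: ltW].
Qed.

(* A half interval [(a',c')] of [(a,c)]; the two representatives are compared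
   through their mean square deviations on the smaller shell. *)
Let rep_half a c a' c' A A' : 1 <= a -> a <= a' -> c' <= c -> a < c ->
  c' - a' = (c - a) / 2 -> rep a c A -> rep a' c' A' ->
  `|A' - A| <= kap * (c - a) `^ sg * g.
Proof.
move=> a1 aa' cc' ac hh rA rA'.
pose h := c - a; have h0 : 0 < h by rewrite subr_gt0.
have mS : measurable (shell a c : set (RN R N)) by exact: measurable_shell.
have mS' : measurable (shell a' c' : set (RN R N)) by exact: measurable_shell.
have a'c' : a' <= c' by rewrite -subr_ge0 hh divr_ge0// ltW.
have a'0 : 0 <= a' by lra.
have muS' := mu_shell mu_leb N_gt0 a'0 a'c'; rewrite -/om hh -/h in muS'.
have sub : shell a' c' `<=` (shell a c : set (RN R N)).
  by move=> x /andP[h1 h2]; apply/andP; split; [exact: le_trans h1|exact: lt_le_trans cc'].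
have dev0 B x : (0 <= (dev B x)%:E)%E by rewrite lee_fin sqr_ge0.
have mdevS B : measurable_fun (shell a' c') (fun x => (dev B x)%:E).
  by apply: measurable_funTS; apply/measurable_EFinP.
have h1 : (\int[mu]_(x in shell a' c') (dev A x)%:E <= (repC * h `^ (2 * s) * g ^+ 2)%:E)%E.
  apply: (@le_trans _ _ (\int[mu]_(x in shell a c) (dev A x)%:E)%E).
    apply: ge0_subset_integral => //.
    by apply: measurable_funTS; apply/measurable_EFinP.
  apply: (le_trans rA); rewrite [in leRHS]EFinM lee_wpmul2l//.
  by rewrite lee_fin mulr_ge0 ?repC_ge0// powR_ge0.
have h2 : (\int[mu]_(x in shell a' c') (dev A' x)%:E <= (repC * h `^ (2 * s) * g ^+ 2)%:E)%E.
  apply: (le_trans rA'); rewrite [in leRHS]EFinM; apply: lee_pmul => //.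
    by rewrite lee_fin mulr_ge0 ?repC_ge0// powR_ge0.
  rewrite lee_fin ler_wpM2l ?repC_ge0// hh ge0_ler_powR ?nnegrE ?divr_ge0 ?mulr_ge0 ?(ltW s_gt0) ?(ltW h0)//.
  by rewrite -/h; lra.
have h3 : (((A' - A) ^+ 2)%:E * mu (shell a' c') <=
    2%:E * (repC * h `^ (2 * s) * g ^+ 2)%:E + 2%:E * (repC * h `^ (2 * s) * g ^+ 2)%:E)%E.
  apply: (@le_trans _ _ (2%:E * \int[mu]_(x in shell a' c') (dev A' x)%:E +
      2%:E * \int[mu]_(x in shell a' c') (dev A x)%:E)%E); last first.
    by apply: leeD; rewrite lee_wpmul2l.
  rewrite -!ge0_integralZl_EFin// -ge0_integralD//; last 4 first.
  - by move=> x _; rewrite mule_ge0.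
  - exact: measurable_funeM.
  - by move=> x _; rewrite mule_ge0.
  - exact: measurable_funeM.
  rewrite -(integral_cst mu mS' ((A' - A) ^+ 2)%:E).
  apply: ge0_le_integral => //.
  - by move=> x _; rewrite lee_fin sqr_ge0.
  - by apply: emeasurable_funD; exact: measurable_funeM.
  move=> x _; rewrite -!EFinM -EFinD lee_fin /dev.
  have := sqr_ge0 ((u x - A') + (u x - A)); nra.
have h4 : (A' - A) ^+ 2 <= (kap * h `^ sg * g) ^+ 2.
  have hE : h `^ (2 * s) = h * (h `^ sg) ^+ 2.
    have -> : 2 * s = 1 + sg * 2%:R by rewrite /sg; field.
    rewrite powRD; last by apply/implyP => _; rewrite gt_eqF.
    by rewrite powRr1 ?(ltW h0)// powRrM powR_mulrn// powR_ge0.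
  move: h3; rewrite muS' -!EFinM -EFinD lee_fin hE => h3.
  rewrite !exprMn kapE.
  have omh : 0 < om * (h / 2) by rewrite mulr_gt0// divr_gt0.
  rewrite -(ler_pM2r omh) (le_trans h3)// le_eqVlt; apply/orP; left; apply/eqP.
  by field; rewrite gt_eqF.
rewrite -(ler_pXn2r (n := 2))// ?nnegrE ?mulr_ge0 ?sqrtr_ge0 ?powR_ge0//.
by rewrite real_normK ?num_real.
Qed.

Let eps (h : R) : R := oscC * h `^ sg * g.

Let eps_ge0 h : 0 <= eps h.
Proof.
by apply: mulr_ge0 => //; apply: mulr_ge0; [exact: oscC_ge0|exact: powR_ge0].
Qed.

(** The tolerance [eps] is designed for this identity: tolerance on a half shell plus jump between
    representatives equals tolerance on the whole shell. *)
Let eps_half h : 0 < h -> eps (h / 2) + kap * h `^ sg * g = eps h.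
Proof.
move=> h0; rewrite /eps powRM ?(ltW h0) ?invr_ge0//.
have -> : 2^-1 `^ sg = 2 `^ (- sg) :> R.
  by rewrite -powR_inv1// -powRrM mulN1r.
have hk : kap = oscC * (1 - 2 `^ (- sg)).
  by rewrite /oscC divfK// gt_eqF// subr_gt0 powR2N_lt1.
rewrite {1}hk; ring.
Qed.

(** Squared excess over a tolerance. Its integral vanishes exactly when [|u - A| <= e] almost
    everywhere, and with tolerance [eps] it is dominated by the excess attached to either half shell
    ([exc_le_half]). *)
Let exc (A e : R) (x : RN R N) : R := (Num.max 0 (`|u x - A| - e)) ^+ 2.

Let exc_ge0 A e x : (0 <= (exc A e x)%:E)%E.
Proof. by rewrite lee_fin sqr_ge0. Qed.

Let mexc A e : measurable_fun setT (fun x => (exc A e x)%:E).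
Proof.
apply/measurable_EFinP; apply: measurable_funX; apply: measurable_maxr => //.
apply: measurable_funB => //; apply: measurableT_comp; first exact: normr_measurable.
exact: measurable_funB.
Qed.

Let exc_le_half a c a' c' A A' x : 1 <= a -> a <= a' -> c' <= c -> a < c ->
  c' - a' = (c - a) / 2 -> rep a c A -> rep a' c' A' ->
  exc A (eps (c - a)) x <= exc A' (eps (c' - a')) x.
Proof.
move=> a1 aa' cc' ac hh rA rA'.
have := rep_half a1 aa' cc' ac hh rA rA'.
rewrite hh -(eps_half (h := c - a)) ?subr_gt0// /exc => hAA.
apply: lerXn2r; [by rewrite nnegrE le_max lexx|by rewrite nnegrE le_max lexx|].
rewrite ge_max le_max lexx/= le_max.
have : `|u x - A| <= `|u x - A'| + `|A' - A|.
  by rewrite (le_trans _ (ler_normD _ _))// addrA subrK.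
by move=> ?; apply/orP; right; lra.
Qed.

(** Induction on the number of bisections: each half has width [(c - a) / 2], and the energies of
    the two halves add up to [E a c]. Thus the number of pieces costs nothing while the prefactor
    shrinks like [2 ^ (- 2 s l)]. *)
Let exc_integral_le l : forall a c A, 1 <= a -> a < c -> c <= b -> rep a c A ->
  (\int[mu]_(x in shell a c) (exc A (eps (c - a)) x)%:E <=
     (repC * ((c - a) / 2 ^+ l) `^ (2 * s))%:E * E a c)%E.
Proof.
elim: l => [|l IH] a c A a1 ac cb rA.
  rewrite expr0 divr1; apply: le_trans rA; apply: ge0_le_integral => //.
  - exact: measurable_shell.
  - exact: measurable_funTS.
  - by apply: measurable_funTS; apply/measurable_EFinP.
  move=> x _; rewrite lee_fin /exc /dev -[leRHS]real_normK ?num_real//.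
  apply: lerXn2r; [by rewrite nnegrE le_max lexx|by rewrite nnegrE normr_ge0|].
  rewrite ge_max normr_ge0/=.
  by rewrite gerDl oppr_le0.
pose m := (a + c) / 2.
have [am mc] : a < m /\ m < c by rewrite /m; split; lra.
have h1 : m - a = (c - a) / 2 by rewrite /m; field.
have h2 : c - m = (c - a) / 2 by rewrite /m; field.
have m1 : 1 <= m by lra.
have mb : m <= b by lra.
have [A1 rA1] := exists_rep a1 am mb.
have [A2 rA2] := exists_rep m1 mc cb.
have mS1 : measurable (shell a m : set (RN R N)) by exact: measurable_shell.
have mS2 : measurable (shell m c : set (RN R N)) by exact: measurable_shell.
have SE : shell a c = shell a m `|` (shell m c : set (RN R N)).
  apply/seteqP; split=> x; rewrite /shell/=.
    by case/andP=> ax xc; have [|] := ltP (enorm x ^+ N) m => hm;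
      [left|right]; rewrite ?ax ?xc ?hm.
  case=> /andP[h3 h4]; first by rewrite h3 (lt_trans h4).
  by rewrite h4 andbT (le_trans _ h3)// ltW.
have dis : [disjoint shell a m & (shell m c : set (RN R N))].
  apply/disj_set2P; apply/seteqP; split=> // x [/andP[_ h3] /andP[h4 _]].
  by have := lt_le_trans h3 h4; rewrite ltxx.
have split_int f : measurable_fun setT f -> (forall x, (0 <= f x)%E) ->
  (\int[mu]_(x in shell a c) f x =
   \int[mu]_(x in shell a m) f x + \int[mu]_(x in shell m c) f x)%E.
  move=> mf f0; rewrite SE; apply: ge0_integral_setU => //.
  exact: measurable_funTS.
rewrite /E (split_int _ mk (gagk_ge0 mu s u)).
rewrite (split_int _ (@mexc A (eps (c - a))) (exc_ge0 _ _)).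
rewrite ge0_muleDr ?E_ge0//.
have hl : (c - a) / 2 ^+ l.+1 = (c - a) / 2 / 2 ^+ l.
  by rewrite exprS; field; rewrite expf_neq0.
have mono a' c' A' : a <= a' -> c' <= c -> c' - a' = (c - a) / 2 -> rep a' c' A' ->
  (\int[mu]_(x in shell a' c') (exc A (eps (c - a)) x)%:E <=
   \int[mu]_(x in shell a' c') (exc A' (eps (c' - a')) x)%:E)%E.
  move=> aa' cc' hh rA'; apply: ge0_le_integral => //.
  - exact: measurable_shell.
  - exact: measurable_funTS.
  - exact: measurable_funTS.
  by move=> x _; rewrite lee_fin; exact: (exc_le_half x a1 aa' cc' ac hh rA rA').
apply: leeD.
  rewrite hl -h1; apply: le_trans (IH _ _ _ a1 am mb rA1).
  by apply: mono => //; exact: ltW.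
rewrite hl -h2; apply: le_trans (IH _ _ _ m1 mc cb rA2).
by apply: mono => //; exact: ltW.
Qed.

(** The integral of the excess is below every term of a geometric sequence, hence zero. *)
Lemma shell_oscillation a c : 1 <= a -> a < c -> c <= b ->
  exists A, {ae mu, forall x, shell a c x -> `|u x - A| <= oscC * (c - a) `^ (s - 2^-1) * g}.
Proof.
move=> a1 ac cb; have [A rA] := exists_rep a1 ac cb; exists A.
have mS : measurable (shell a c : set (RN R N)) by exact: measurable_shell.
have h0 : 0 < c - a by rewrite subr_gt0.
pose I := (\int[mu]_(x in shell a c) (exc A (eps (c - a)) x)%:E)%E.
have I0 : (0 <= I)%E by exact: integral_ge0.
have Ile l : (I <= (repC * ((c - a) / 2 ^+ l) `^ (2 * s) * g ^+ 2)%:E)%E.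
  apply: (le_trans (exc_integral_le l a1 ac cb rA)).
  by rewrite [in leRHS]EFinM lee_wpmul2l// lee_fin mulr_ge0 ?repC_ge0 ?powR_ge0.
have Ifin : I \is a fin_num by rewrite ge0_fin_numE// (le_lt_trans (Ile 0%N))// ltry.
have : (I <= 0)%E.
  rewrite -(fineK Ifin) lee_fin.
  apply: (@le_geometric_le0 _ _ (repC * (c - a) `^ (2 * s) * g ^+ 2) (2 `^ (- (2 * s)))).
    by rewrite powR_ge0/= powR2N_lt1// mulr_gt0.
  move=> l; rewrite -lee_fin (fineK Ifin) (le_trans (Ile l))// lee_fin.
  rewrite le_eqVlt; apply/orP; left; apply/eqP.
  rewrite powRM ?(ltW h0) ?invr_ge0 ?exprn_ge0//.
  have -> : (2 ^+ l)^-1 `^ (2 * s) = (2 `^ (- (2 * s))) ^+ l :> R.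
    rewrite -powR_inv1 ?exprn_ge0// -[2 ^+ l]powR_mulrn// -powRrM -[LHS]powRrM.
    rewrite -[RHS]powR_mulrn ?powR_ge0// -[RHS]powRrM.
    by congr (_ `^ _); ring.
  ring.
move/(ge0_integral_eq0_ae mS (measurable_funTS (@mexc A (eps (c - a)))) (fun x _ => exc_ge0 _ _ x)).
apply: filterS => x h Sx; have /eqP := h Sx.
rewrite eqe /exc sqrf_eq0 => /eqP hx.
have : `|u x - A| - eps (c - a) <= 0 by rewrite -hx le_max lexx orbT.
by rewrite subr_le0.
Qed.

End Oscillation.

(** * Decay of radial functions *)

Section AlmostEverywhere.
Context {R : realType} {N : nat}.
Variable mu : {measure set (RN R N) -> \bar R}.
Hypothesis mu_leb : is_lebesgue mu.

Lemma ae_dil (l : R) (Q : RN R N -> Prop) : 0 < l ->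
  {ae mu, forall x, Q x} -> {ae mu, forall x, Q (dil l x)}.
Proof.
move=> l0 [Z [mZ Z0 QZ]]; exists (dil l @^-1` Z); split.
- by rewrite -[X in measurable X]setTI; exact: measurable_dil.
- by have := mu_dil mu_leb l0 mZ; rewrite Z0 mule0.
- by move=> x /= Qx; apply: QZ.
Qed.

Lemma ae_exists (S : set (RN R N)) (Q : RN R N -> Prop) :
  measurable S -> (0 < mu S)%E -> {ae mu, forall x, Q x} -> exists2 x, S x & Q x.
Proof.
move=> mS S0 [Z [mZ Z0 QZ]]; apply: contrapT => h.
have : (mu S <= mu Z)%E.
  by apply: le_measure; rewrite ?inE// => x Sx; apply: QZ => /= Qx; apply: h; exists x.
by rewrite Z0 leNgt S0.
Qed.

End AlmostEverywhere.

(** * Scaling of the Gagliardo energy *)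

Section Scaling.
Context {R : realType} {N : nat}.
Variable mu : {sigma_finite_measure set (RN R N) -> \bar R}.
Hypothesis mu_leb : is_lebesgue mu.
Hypothesis N_gt0 : (0 < N)%N.

Lemma radial_dil (u : RN R N -> R) l : radial u -> radial (u \o dil l).
Proof. by move=> ru x y xy; apply: ru; rewrite !enorm_dil xy. Qed.

Lemma measurable_comp_dil (u : RN R N -> R) l :
  measurable_fun setT u -> measurable_fun setT (u \o dil l).
Proof. by move=> mu_; apply: measurableT_comp => //; exact: measurable_dil. Qed.

Lemma kern_dil s (u : RN R N -> R) l x y : 0 < l ->
  kern s (u \o dil l) x y = l `^ (N%:R + 2 * s) * kern s u (dil l x) (dil l y).
Proof.
move=> l0; rewrite /kern/=.
have -> : (fun i => dil l x i - dil l y i) = dil l (fun i => x i - y i).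
  by apply/funext => i; rewrite /dil mulrBr.
rewrite enorm_dil (gtr0_norm l0) powRM ?(ltW l0) ?enorm_ge0// invfM.
have l1 : l `^ (N%:R + 2 * s) != 0 by rewrite gt_eqF// powR_gt0.
by rewrite mulrCA (mulrA (_ `^ _)) divff// mul1r.
Qed.

(** The kernel contributes [l ^ (N + 2s)] and each of the two substitutions [l ^- N], which leaves
    the exponent [2s - N]. *)
Lemma gag_dil s (u : RN R N -> R) l : 0 < l -> measurable_fun setT u ->
  gag mu s (u \o dil l) = ((l `^ (2 * s - N%:R))%:E * gag mu s u)%E.
Proof.
move=> l0 mu_.
have lP : 0 <= l `^ (N%:R + 2 * s) by exact: powR_ge0.
have E1 x : gagk mu s (u \o dil l) x =
   ((l `^ (N%:R + 2 * s) * l ^- N)%:E * gagk mu s u (dil l x))%E.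
  rewrite /gagk; under eq_integral do rewrite kern_dil// EFinM.
  have mkl : measurable_fun setT (fun y => (kern s u (dil l x) y)%:E).
    exact: measurable_kern_l.
  have kl0 y : (0 <= (kern s u (dil l x) y)%:E)%E by rewrite lee_fin kern_ge0.
  have mkl' := measurableT_comp mkl (measurable_dil l).
  rewrite (ge0_integralZl_EFin mu measurableT (fun y _ => kl0 (dil l y)) mkl' lP).
  by rewrite (ge0_integral_dilT mu_leb l0 mkl kl0) muleA -EFinM.
have mg : measurable_fun setT (gagk mu s u) by exact: measurable_gagk.
have g0 x : (0 <= gagk mu s u x)%E by exact: gagk_ge0.
have lN0 : 0 <= l ^- N by rewrite invr_ge0 exprn_ge0// ltW.
rewrite /gag (eq_integral _ _ (fun x _ => E1 x)).
move: (gagk mu s u) mg g0 {E1} => G mG G0.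
have mG' : measurable_fun setT (fun x => G (dil l x)).
  by apply: measurableT_comp => //; exact: measurable_dil.
rewrite (ge0_integralZl_EFin mu measurableT (fun x _ => G0 (dil l x)) mG' (mulr_ge0 lP lN0)).
rewrite (ge0_integral_dilT mu_leb l0 mG G0) muleA -EFinM; congr ((_)%:E * _)%E.
rewrite -powR_mulrn ?(ltW l0)// -powRN -!powRD.
- by congr (_ `^ _); ring.
- by apply/implyP => _; rewrite gt_eqF.
- by apply/implyP => _; rewrite gt_eqF.
Qed.

Lemma gag_dil_le s (u : RN R N -> R) l g : 0 < l -> measurable_fun setT u ->
  (gag mu s u <= (g ^+ 2)%:E)%E ->
  (gag mu s (u \o dil l) <= ((l `^ (s - N%:R / 2) * g) ^+ 2)%:E)%E.
Proof.
move=> l0 mu_ ug; rewrite gag_dil// exprMn [leRHS]EFinM.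
have -> : (l `^ (s - N%:R / 2)) ^+ 2 = l `^ (2 * s - N%:R).
  by rewrite -powR_mulrn ?powR_ge0// -powRrM; congr (_ `^ _); field.
by rewrite lee_wpmul2l// lee_fin powR_ge0.
Qed.

End Scaling.

Section RadialDecay.
Context {R : realType} {N : nat}.
Variable mu : {sigma_finite_measure set (RN R N) -> \bar R}.
Hypothesis mu_leb : is_lebesgue mu.
Hypothesis N_gt0 : (0 < N)%N.
Variable s : R.
Hypothesis s_gt2 : 2^-1 < s.
Hypothesis s_ltN : 2 * s < N%:R.

(** The exponent [N.+1], instead of [N], makes the base shell overlap its dilate by 2, along
    [2^N <= |x|^N < 2^(N+1)]. *)
Let B : R := 2 ^+ N.+1.
Let B_gt1 : 1 < B. Proof. by rewrite exprn_egt1// ltr1n. Qed.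
Let Om : set (RN R N) := shell 1 B.
Let mOm : measurable Om. Proof. exact: measurable_shell. Qed.
(** Factor gained by the seminorm bound under [u -> u(2 x)]; it is below 1 because [2s < N]. *)
Let th : R := 2 `^ (s - N%:R / 2).
Let th_ge0 : 0 <= th. Proof. exact: powR_ge0. Qed.
Let th_lt1 : th < 1.
Proof.
rewrite /th (_ : s - _ = - (N%:R / 2 - s)); last by rewrite opprB.
by rewrite powR2N_lt1// subr_gt0 ltr_pdivlMr// mulrC.
Qed.

Let C : R := oscC mu s B * (B - 1) `^ (s - 2^-1).
Let C_ge0 : 0 <= C.
Proof. by apply: mulr_ge0; [apply: oscC_ge0 => //; exact: ltW|exact: powR_ge0]. Qed.

(** The fraction sums the differences of consecutive constants; of the remaining [2 * C], one [C]
    bounds a far constant ([const_tail]) and the other the oscillation of [u] on the base shell. *)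
Definition supC : R := 2 * C / (1 - th) + 2 * C.

Lemma supC_ge0 : 0 <= supC.
Proof.
apply: addr_ge0; last exact: mulr_ge0.
by apply: divr_ge0; [exact: mulr_ge0|rewrite subr_ge0 ltW].
Qed.

Section OneFunction.
Variable u : RN R N -> R.
Hypotheses (mu_ : measurable_fun setT u) (ru : radial u).
Variables (g p : R).
Hypotheses (g_ge0 : 0 <= g) (gag_le : (gag mu s u <= (g ^+ 2)%:E)%E).
Hypotheses (p_gt0 : 0 < p) (up : (\int[mu]_x (`|u x| `^ p)%:E < +oo)%E).

Let uj (j : nat) := u \o dil (2 ^+ j).

Let near_const (A : nat -> R) :=
  forall j, {ae mu, forall x, Om x -> `|uj j x - A j| <= C * th ^+ j * g}.

Let exists_const : exists A, near_const A.
Proof.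
have h j : exists A, {ae mu, forall x, Om x -> `|uj j x - A| <= C * th ^+ j * g}.
  have l0 : 0 < 2 ^+ j :> R by rewrite exprn_gt0.
  have lE : (2 ^+ j) `^ (s - N%:R / 2) = th ^+ j.
    rewrite -[2 ^+ j]powR_mulrn// -powRrM mulrC powRrM powR_mulrn//.
  have := gag_dil_le mu_leb l0 mu_ gag_le; rewrite lE => gj.
  have [A hA] := @shell_oscillation _ _ mu mu_leb N_gt0 s s_gt2 B (ltW B_gt1) (uj j)
    (measurable_comp_dil _ mu_) (radial_dil _ ru) _ (mulr_ge0 (exprn_ge0 j th_ge0) g_ge0)
    gj 1 B (lexx _) B_gt1 (lexx _).
  by exists A; apply: filterS hA => x hx /hx; rewrite /C !mulrA.
by have [A hA] := choice h; exists A.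
Qed.

(** At a point [x] of the overlap, both [x] and [x / 2] lie in the base shell, and [uj j.+1 (x / 2)]
    and [uj j x] are the same value of [u]; so it is close to both constants. *)
Let const_step A : near_const A -> forall j,
  `|A j - A j.+1| <= 2 * C * g * th ^+ j.
Proof.
move=> hA j.
have S0 : (0 < mu (shell (2 ^+ N) B : set (RN R N)))%E.
  rewrite mu_shell// ?lte_fin ?mulr_gt0 ?omega_gt0 ?subr_gt0 ?ltr_eXn2l ?ltr1n ?exprn_ge0//.
  by rewrite ler_eXn2l ?ltr1n.
have h2 : 0 < 2^-1 :> R by [].
have hj := hA j.
have hj1 := ae_dil mu_leb h2 (hA j.+1).
have mSN : measurable (shell (2 ^+ N) B : set (RN R N)) by exact: measurable_shell.
have [x Sx [h3 h4]] := ae_exists mSN S0 (filterI hj hj1).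
have [Sx1 Sx2] := andP Sx.
have Ox : Om x by rewrite /Om/shell/= (le_trans _ Sx1) ?exprn_ege1 ?ler1n.
have Ox2 : Om (dil 2^-1 x).
  rewrite /Om/shell/= enorm_dil gtr0_norm// exprMn exprVn.
  rewrite ler_pdivlMl ?exprn_gt0// mulr1 Sx1/= ltr_pdivrMl ?exprn_gt0//.
  apply: (lt_le_trans Sx2); rewrite ler_peMl ?(le_trans _ (ltW B_gt1))//.
  by rewrite exprn_ege1 ?ler1n.
have {h3} := h3 Ox; have {h4} := h4 Ox2.
have -> : uj j.+1 (dil 2^-1 x) = uj j x.
  by rewrite /uj/= dil_dil exprS (mulrC 2) mulfK.
have t1 : C * th ^+ j.+1 * g <= C * th ^+ j * g.
  by rewrite ler_wpM2r// ler_wpM2l// exprS ler_piMl ?exprn_ge0// ltW.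
move=> h4 h3.
have : `|A j - A j.+1| <= `|uj j x - A j| + `|uj j x - A j.+1|.
  by rewrite (distrC (uj j x) (A j)) ler_distD.
lra.
Qed.

(** If every constant exceeded its error by [tau], then [|uj j| >= tau] on the base shell for all
    [j], whereas the integral of [|uj j| ^ p] is [2 ^ (- j N)] times that of [|u| ^ p] and tends to
    0. This is how integrability at infinity rules out nonzero limits of the constants. *)
Let const_tail A : near_const A -> forall tau, 0 < tau ->
  exists j, `|A j| <= C * th ^+ j * g + tau.
Proof.
move=> hA tau tau0; apply: contrapT => h.
have {}h j : C * th ^+ j * g + tau < `|A j|.
  by rewrite ltNge; apply/negP => hj; apply: h; exists j.
pose Z := (\int[mu]_x (`|u x| `^ p)%:E)%E.
have Z0 : (0 <= Z)%E by apply: integral_ge0 => x _; rewrite lee_fin powR_ge0.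
have Zfin : Z \is a fin_num by rewrite ge0_fin_numE.
have mup : measurable_fun setT (fun x => (`|u x| `^ p)%:E).
  apply/measurable_EFinP; apply: (measurableT_comp (measurable_powR p)).
  by apply: (measurableT_comp (@normr_measurable _ _)).
have up0 x : (0 <= (`|u x| `^ p)%:E)%E by rewrite lee_fin powR_ge0.
have muOm := mu_shell mu_leb N_gt0 ler01 (ltW B_gt1).
have X0 : 0 < tau `^ p * (omega mu * (B - 1)).
  by rewrite mulr_gt0 ?powR_gt0// mulr_gt0 ?omega_gt0// subr_gt0.
have key j : tau `^ p * (omega mu * (B - 1)) <= fine Z * ((2 ^+ N)^-1) ^+ j.
  have l0 : 0 < 2 ^+ j :> R by rewrite exprn_gt0.
  have mupj : measurable_fun setT (fun x => (`|uj j x| `^ p)%:E).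
    by apply: (measurableT_comp mup); exact: measurable_dil.
  rewrite -lee_fin EFinM -muOm -(integral_cst mu mOm (tau `^ p)%:E).
  apply: (@le_trans _ _ (\int[mu]_(x in Om) (`|uj j x| `^ p)%:E)%E).
    apply: ae_ge0_le_integral => //.
    - by move=> x _; rewrite lee_fin powR_ge0.
    - exact: (measurable_funTS mupj).
    apply: filterS (hA j) => x hx Ox; rewrite lee_fin.
    apply: ge0_ler_powR; rewrite ?nnegrE ?(ltW p_gt0) ?(ltW tau0)//.
    have := hx Ox; have := h j.
    have : `|A j| <= `|uj j x| + `|uj j x - A j|.
      by rewrite distrC (le_trans _ (ler_normD _ _))// addrC subrK.
    lra.
  apply: (@le_trans _ _ (\int[mu]_x (`|uj j x| `^ p)%:E)%E).
    by apply: ge0_subset_integral => // x _; rewrite lee_fin powR_ge0.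
  rewrite (ge0_integral_dilT mu_leb l0 mup up0) -/Z -(fineK Zfin) -EFinM lee_fin.
  by rewrite mulrC exprVn -!exprM mulnC.
have : tau `^ p * (omega mu * (B - 1)) <= 0.
  apply: le_geometric_le0 key; rewrite invr_ge0 exprn_ge0//= invf_lt1 ?exprn_gt0//.
  by rewrite exprn_egt1// ?ltr1n// -lt0n.
by rewrite leNgt X0.
Qed.

Lemma radial_bound_base : {ae mu, forall x, Om x -> `|u x| <= supC * g}.
Proof.
have [A hA] := exists_const.
pose K := 2 * C * g / (1 - th).
have th1 : 0 < 1 - th by rewrite subr_gt0.
have K0 : 0 <= K by apply: divr_ge0; [rewrite mulr_ge0// mulr_ge0|exact: ltW].
have tele j : `|A 0%N| <= K * (1 - th ^+ j) + `|A j|.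
  elim: j => [|j IH]; first by rewrite expr0 subrr mulr0 add0r.
  apply: (le_trans IH).
  have E : K * (1 - th ^+ j.+1) = K * (1 - th ^+ j) + 2 * C * g * th ^+ j.
    by rewrite exprS /K; field; rewrite gt_eqF.
  have := const_step hA j.
  have : `|A j| <= `|A j - A j.+1| + `|A j.+1|.
    by rewrite (le_trans _ (ler_normD _ _))// subrK.
  lra.
have A0 : `|A 0%N| <= K + C * g.
  apply/ler_addgt0Pr => tau tau0; have [j hj] := const_tail hA tau0.
  have tj : 0 <= th ^+ j <= 1 by rewrite exprn_ge0// exprn_ile1// ltW.
  have [tj0 tj1] := andP tj.
  have h1 : K * (1 - th ^+ j) <= K by rewrite ler_piMr// gerBl.
  have h2 : C * th ^+ j * g <= C * g by rewrite ler_wpM2r// ler_piMr.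
  by have := tele j; lra.
apply: filterS (hA 0%N) => x hx /hx; rewrite /uj/= expr0 dil1 mulr1 => h.
have : `|u x| <= `|u x - A 0%N| + `|A 0%N|.
  by rewrite (le_trans _ (ler_normD _ _))// subrK.
have -> : supC * g = K + C * g + C * g.
  by rewrite /supC /K; field; rewrite gt_eqF.
lra.
Qed.

End OneFunction.

Lemma integral_powR_dil_lt (u : RN R N -> R) p l : 0 < l -> measurable_fun setT u ->
  (\int[mu]_x (`|u x| `^ p)%:E < +oo)%E ->
  (\int[mu]_x (`|(u \o dil l) x| `^ p)%:E < +oo)%E.
Proof.
move=> l0 mu_ up.
have mup : measurable_fun setT (fun x => (`|u x| `^ p)%:E).
  apply/measurable_EFinP; apply: (measurableT_comp (measurable_powR p)).
  by apply: (measurableT_comp (@normr_measurable _ _)).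
have up0 x : (0 <= (`|u x| `^ p)%:E)%E by rewrite lee_fin powR_ge0.
rewrite (ge0_integral_dilT mu_leb l0 mup up0) lte_mul_pinfty// lee_fin.
by rewrite invr_ge0 exprn_ge0// ltW.
Qed.

(** The dilates of the base shell by [r * 2 ^ i] cover the exterior of the ball of radius [r]; as
    [s - N/2 < 0], the innermost one has the largest bound. *)
Lemma radial_bound (u : RN R N -> R) g p r :
  measurable_fun setT u -> radial u -> 0 <= g -> (gag mu s u <= (g ^+ 2)%:E)%E ->
  0 < p -> (\int[mu]_x (`|u x| `^ p)%:E < +oo)%E -> 0 < r ->
  {ae mu, forall x : RN R N, r <= enorm x -> `|u x| <= supC * (r `^ (s - N%:R / 2) * g)}.
Proof.
move=> mu_ ru g0 ug p0 up r0.
pose l (i : nat) : R := r * 2 ^+ i.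
have l0 i : 0 < l i by rewrite mulr_gt0// exprn_gt0.
have h i : {ae mu, forall x, Om (dil (l i)^-1 x) -> `|u x| <= supC * (r `^ (s - N%:R / 2) * g)}.
  have li0 : 0 < (l i)^-1 by rewrite invr_gt0.
  have := radial_bound_base (measurable_comp_dil (l i) mu_) (radial_dil (l i) ru)
    (mulr_ge0 (powR_ge0 _ _) g0) (gag_dil_le mu_leb (l0 i) mu_ ug) p0
    (integral_powR_dil_lt (l0 i) mu_ up).
  move/(ae_dil mu_leb li0); apply: filterS => x hx /hx/=.
  rewrite dil_dil divff ?gt_eqF// dil1 => /le_trans; apply.
  rewrite ler_wpM2l ?supC_ge0// ler_wpM2r//.
  rewrite (_ : s - _ = - (N%:R / 2 - s)); last by rewrite opprB.
  rewrite !powRN lef_pV2 ?posrE ?powR_gt0//.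
  apply: ge0_ler_powR; rewrite ?nnegrE ?(ltW r0) ?(ltW (l0 i))//.
    by rewrite subr_ge0 ltW// ltr_pdivlMr// mulrC.
  by rewrite /l ler_peMr ?(ltW r0)// exprn_ege1 ?ler1n.
apply: filterS (ae_foralln h) => x hx rx.
have [i [li1 li2]] : exists i, l i <= enorm x /\ enorm x < l i.+1.
  have ex : exists i, enorm x < l i.
    have x1 : 0 <= enorm x / r by rewrite divr_ge0 ?enorm_ge0// ltW.
    exists (Num.truncn (enorm x / r)).+1; rewrite /l mulrC -ltr_pdivrMr//.
    apply: (lt_trans (truncnS_gt _)).
    by rewrite -natrX ltr_nat ltn_expl.
  case: (ex_minnP ex) => -[|i] hi mini.
    by move: hi; rewrite /l expr0 mulr1 ltNge rx.
  by exists i; split=> //; rewrite leNgt; apply/negP => /mini; rewrite ltnn.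
apply: (hx i); rewrite /Om/shell/= enorm_dil gtr0_norm ?invr_gt0//.
have x1 : 1 <= (l i)^-1 * enorm x by rewrite ler_pdivlMl// mulr1.
rewrite exprn_ege1//=.
have x2 : (l i)^-1 * enorm x <= 2.
  by rewrite ler_pdivrMl// (le_trans (ltW li2))// /l exprSr mulrA.
apply: (@le_lt_trans _ _ (2 ^+ N)); last by rewrite ltr_eXn2l ?ltr1n.
by apply: lerXn2r; rewrite ?nnegrE// (le_trans _ x1).
Qed.

End RadialDecay.

(** * Local compactness *)

Lemma near_forall_seq {T : Type} {F : set_system T} {FF : Filter F} {I : eqType}
    (l : seq I) (P : I -> T -> Prop) :
  (forall i, i \in l -> \forall x \near F, P i x) ->
  \forall x \near F, forall i, i \in l -> P i x.
Proof.
elim: l => [|i l IH] h; first by apply: nearW.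
have hi := h i (mem_head _ _).
have hl : \forall x \near F, forall j, j \in l -> P j x.
  by apply: IH => j jl; apply: h; rewrite inE jl orbT.
apply: filterS2 hi hl => x xi xl j; rewrite inE => /orP[/eqP->//|]; exact: xl.
Qed.

(** By Tychonoff the sequence has a cluster point [p] in a product of segments. The [k]-th term of
    the subsequence is chosen within [1/(k+1)] of [p] in the finitely many coordinates of code at
    most [k], which forces convergence in each coordinate. *)
Lemma bounded_family_subsequence {R : realType} {I : countType}
    (x : nat -> I -> R) (B : I -> R) :
  (forall n i, `|x n i| <= B i) ->
  exists phi : nat -> nat, {homo phi : m n / (m < n)%N >-> (m < n)%N} /\
    exists p : I -> R, forall i, x (phi n) i @[n --> \oo] --> p i.
Proof.
move=> xB.
pose A (i : I) : set R := `[- B i, B i]%classic.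
have cA : compact ([set f | forall i, A i (f i)] : set (prod_topology (fun _ : I => R))).
  by apply: tychonoff => i; exact: segment_compact.
pose F : set_system (prod_topology (fun _ : I => R)) := x @ \oo.
have FF : ProperFilter F by exact: fmap_proper_filter.
have FA : F [set f | forall i, A i (f i)].
  by exists 0%N => // n _ i; rewrite /A/= in_itv/= -ler_norml.
have [p [_ clp]] := cA F FF FA.
have step k m : exists n, (m <= n)%N /\
    forall i, (pickle i <= k)%N -> `|x n i - p i| < k.+1%:R^-1.
  have e0 : 0 < k.+1%:R^-1 :> R by rewrite invr_gt0.
  have nbi i : nbhs p [set f : prod_topology (fun _ : I => R) | `|f i - p i| < k.+1%:R^-1].
    have cp := @proj_continuous I (fun=> (R : topologicalType)) i p.
    have nbR : nbhs (proj i p : R) [set y : R | `|y - p i| < k.+1%:R^-1].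
      have := nbhsx_ballx (p i : R) _ e0; apply: filterS => y.
      by rewrite /ball/= distrC.
    exact: (cp _ nbR).
  pose l := pmap unpickle (iota 0 k.+1) : seq I.
  have nb : nbhs p [set f : prod_topology (fun _ : I => R) |
      forall i, i \in l -> `|f i - p i| < k.+1%:R^-1].
    have FFp : Filter (nbhs p) by exact: nbhs_filter.
    exact: (@near_forall_seq (prod_topology (fun _ : I => R)) (nbhs p) FFp I l
      (fun i f => `|f i - p i| < k.+1%:R^-1) (fun i _ => nbi i)).
  have Fm : F [set f | exists2 n, (m <= n)%N & f = x n].
    by exists m => // n mn; exists n.
  have [_ [[n mn ->] hn]] := clp _ _ Fm nb.
  exists n; split=> // i ik; apply: hn.
  by rewrite mem_pmap; apply/mapP; exists (pickle i); rewrite ?mem_iota ?pickleK.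
pose ch k m := projT1 (cid (step k m)).
have chP k m : (m <= ch k m)%N /\
    forall i, (pickle i <= k)%N -> `|x (ch k m) i - p i| < k.+1%:R^-1.
  by rewrite /ch; case: cid.
pose phi := fix phi k := if k is k'.+1 then ch k (phi k').+1 else ch 0%N 0%N.
have phiS k : (phi k < phi k.+1)%N by exact: (chP k.+1 (phi k).+1).1.
have phiP k i : (pickle i <= k)%N -> `|x (phi k) i - p i| < k.+1%:R^-1.
  by case: k => [|k]; [exact: (chP 0%N 0%N).2|exact: (chP k.+1 (phi k).+1).2].
exists phi; split.
  by apply: homo_ltn; [exact: ltn_trans|exact: phiS].
exists p => i; apply/cvgrPdist_lt => e e0.
have [m hm] := ltr_add_invr e0; rewrite add0r in hm.
near=> k; rewrite distrC (lt_trans (phiP k i _))//.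
  by near: k; exact: nbhs_infty_ge.
apply: le_lt_trans hm; rewrite lef_pV2 ?posrE// ler_nat ltnS.
by near: k; exact: nbhs_infty_ge.
Unshelve. all: by end_near. Qed.

Section LocalCompactness.
Context {R : realType} {N : nat}.
Variable mu : {sigma_finite_measure set (RN R N) -> \bar R}.
Hypothesis mu_leb : is_lebesgue mu.
Hypothesis N_gt0 : (0 < N)%N.
Variable s : R.
Hypothesis s_gt2 : 2^-1 < s.
Hypothesis s_ltN : 2 * s < N%:R.
Variables (un : nat -> RN R N -> R) (g p : R).
Hypotheses (mun : forall n, measurable_fun setT (un n)) (run : forall n, radial (un n)).
Hypotheses (g_ge0 : 0 <= g) (gag_le : forall n, (gag mu s (un n) <= (g ^+ 2)%:E)%E).
Hypotheses (p_gt0 : 0 < p) (up : forall n, (\int[mu]_x (`|un n x| `^ p)%:E < +oo)%E).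

Let b : R := 2 ^+ N.
Let b_gt1 : 1 < b. Proof. by rewrite exprn_egt1 ?ltr1n// -lt0n. Qed.
Let e : R := s - N%:R / 2.
(** Dyadic scales [2 ^ (i - k)]: [k] sets the innermost radius and [i] numbers the dyadic shells
    outwards from it. *)
Let lam (k i : nat) : R := 2 ^+ i / 2 ^+ k.
Let lam_gt0 k i : 0 < lam k i. Proof. by rewrite divr_gt0 ?exprn_gt0. Qed.
(** The base shell is cut into [m + 1] pieces of this thickness, numbered by [t <= m]. *)
Let hs (m : nat) : R := (b - 1) / m.+1%:R.
Let hs_gt0 m : 0 < hs m. Proof. by rewrite divr_gt0 ?subr_gt0. Qed.
Let piece (m t : nat) : set (RN R N) := shell (1 + t%:R * hs m) (1 + t%:R * hs m + hs m).
Let osc (k i m : nat) : R := oscC mu s b * hs m `^ (s - 2^-1) * (lam k i `^ e * g).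

Let piece_le (m t : nat) : (t <= m)%N -> 1 + t%:R * hs m + hs m <= b.
Proof.
move=> tm; have -> : 1 + t%:R * hs m + hs m = 1 + t.+1%:R * hs m by rewrite -natr1; ring.
have : t.+1%:R * hs m <= b - 1.
  rewrite /hs mulrCA ler_piMr ?subr_ge0 ?(ltW b_gt1)//.
  by rewrite ler_pdivrMr// mul1r ler_nat ltnS.
lra.
Qed.

Let piece_ge1 m t : 1 <= 1 + t%:R * hs m.
Proof. by rewrite lerDl mulr_ge0// ltW. Qed.

(* Values [A n (k, i, m, t)] approximating [un n (lam k i x)] on the pieces
   [t <= m] of the base shell [1 <= |x|^N < 2^N]. *)
Let exists_values : exists A : nat -> nat * nat * nat * nat -> R,
  (forall n k i m t, (t <= m)%N ->
    {ae mu, forall x, piece m t x -> `|un n (dil (lam k i) x) - A n (k, i, m, t)| <= osc k i m}) /\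
  exists B, forall n q, `|A n q| <= B q.
Proof.
(* A value attached to a piece is bounded, independently of [n], by the radial bound at one good
   point of the piece plus the oscillation there. *)
pose Bd (q : nat * nat * nat * nat) : R :=
  let: (k, i, m, t) := q in supC mu s * (lam k i `^ e * g) + osc k i m.
have osc0 k i m : 0 <= osc k i m.
  apply: mulr_ge0; last by rewrite mulr_ge0// powR_ge0.
  by apply: mulr_ge0; [apply: oscC_ge0 => //; exact: ltW|exact: powR_ge0].
have Bd0 q : 0 <= Bd q.
  case: q => [[[k i] m] t]; apply: addr_ge0 => //; apply: mulr_ge0.
    exact: supC_ge0.
  by rewrite mulr_ge0// powR_ge0.
have h (nq : nat * (nat * nat * nat * nat)) : exists A : R,
    (let: (n, (k, i, m, t)) := nq in (t <= m)%N ->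
    {ae mu, forall x, piece m t x -> `|un n (dil (lam k i) x) - A| <= osc k i m}) /\
    `|A| <= Bd nq.2.
  case: nq => n [[[k i] m] t].
  have [tm|tm] := leqP t m; last first.
    (* For [t > m] the piece leaves the base shell; the default 0 merely keeps the family bounded on
       the whole index type. *)
    by exists 0; split=> //; rewrite normr0; exact: Bd0.
  have mul := measurable_comp_dil (lam k i) (mun n).
  have rul := radial_dil (lam k i) (run n).
  have gl := gag_dil_le mu_leb (lam_gt0 k i) (mun n) (gag_le n).
  have g0 : 0 <= lam k i `^ e * g by rewrite mulr_ge0// powR_ge0.
  have ac : 1 + t%:R * hs m < 1 + t%:R * hs m + hs m by rewrite ltrDl.
  have [A hA] := @shell_oscillation _ _ mu mu_leb N_gt0 s s_gt2 b (ltW b_gt1) _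
    mul rul _ g0 gl _ _ (piece_ge1 m t) ac (piece_le tm).
  rewrite (_ : 1 + t%:R * hs m + hs m - (1 + t%:R * hs m) = hs m) in hA; last by ring.
  exists A; split; first by move=> _; exact: hA.
  have hb := @radial_bound _ _ mu mu_leb N_gt0 s s_gt2 s_ltN _ _ p 1 mul rul g0 gl p_gt0
    (integral_powR_dil_lt mu_leb (lam_gt0 k i) (mun n) (up n)) ltr01.
  have mP : measurable (piece m t) by exact: measurable_shell.
  have muP : (0 < mu (piece m t))%E.
    rewrite mu_shell ?(ltW ac)// ?(le_trans _ (piece_ge1 m t))//.
    by rewrite lte_fin mulr_gt0 ?omega_gt0// subr_gt0.
  have [x Px [h1 h2]] := ae_exists mP muP (filterI hA hb).
  have {}h1 := h1 Px.
  have x1 : 1 <= enorm x.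
    rewrite leNgt; apply/negP => x1.
    have : enorm x ^+ N < 1 by rewrite exprn_ilt1 ?enorm_ge0// -lt0n.
    by have /andP[+ _] := Px => /(le_trans (piece_ge1 m t)); rewrite leNgt => /negP.
  have := h2 x1; rewrite powR1 mul1r => {}h2.
  have : `|A| <= `|(un n \o dil (lam k i)) x| + `|(un n \o dil (lam k i)) x - A|.
    by rewrite distrC (le_trans _ (ler_normD _ _))// addrC subrK.
  by rewrite /Bd /osc/=; lra.
have [A hA] := choice h.
exists (fun n q => A (n, q)); split=> [n k i m t tm|].
  by have [+ _] := hA (n, (k, i, m, t)); exact.
by exists Bd => n q; have [_] := hA (n, q).
Qed.

(** The choices are made in the order [k] from [r], [i0] from [r'], [m] from [delta]. Only finitely
    many indices then matter, so one [n0] serves them all. The four quarters of [delta] pay for the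
    oscillations of the two functions and for the distances of their two values to the limit [L]. *)
Lemma radial_subsequence : exists phi : nat -> nat,
  {homo phi : m n / (m < n)%N >-> (m < n)%N} /\
  forall r r' delta, 0 < r -> 0 < delta ->
    exists n0, forall n m, (n0 <= n)%N -> (n0 <= m)%N ->
      {ae mu, forall x : RN R N, r <= enorm x < r' -> `|un (phi n) x - un (phi m) x| <= delta}.
Proof.
have [A [hA [B hB]]] := exists_values.
have [phi [phi_inc [L hL]]] := bounded_family_subsequence hB.
exists phi; split=> // r r' delta r0 d0.
have le_2X (q : nat) : q%:R <= 2 ^+ q :> R by rewrite -natrX ler_nat ltnW// ltn_expl.
have [k hk] : exists k, lam k 0 <= r.
  exists (Num.truncn r^-1).+1; rewrite /lam expr0 mul1r -[leRHS]invrK lef_pV2 ?posrE ?invr_gt0 ?exprn_gt0//.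
  exact: le_trans (ltW (truncnS_gt _)) (le_2X _).
have [i0 hi0] : exists i0, r' <= lam k i0.
  exists (Num.truncn (`|r'| * 2 ^+ k)).+1; rewrite /lam ler_pdivlMr ?exprn_gt0//.
  apply: (@le_trans _ _ (`|r'| * 2 ^+ k)); first by rewrite ler_wpM2r ?exprn_ge0// ler_norm.
  exact: le_trans (ltW (truncnS_gt _)) (le_2X _).
have eneg : e = - (N%:R / 2 - s) by rewrite /e opprB.
have ne0 : 0 <= N%:R / 2 - s by rewrite subr_ge0 ltW// ltr_pdivlMr// mulrC.
have lamS i : lam k i.+1 = 2 * lam k i by rewrite /lam exprS mulrA.
have lam_ge i : lam k 0 <= lam k i.
  by rewrite /lam ler_wpM2r ?invr_ge0 ?exprn_ge0// expr0 exprn_ege1// ler1n.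
(* The exponent [e] is negative, so the scale [lam k 0] has the largest oscillation and [W] serves
   for every [i]. Since [W] may be 0, the division below is by [W + 1]. *)
pose W := oscC mu s b * (lam k 0 `^ e * g).
have oC0 : 0 <= oscC mu s b by apply: oscC_ge0 => //; exact: ltW.
have W0 : 0 <= W by rewrite /W mulr_ge0// mulr_ge0// powR_ge0.
have [m hm] : exists m, W * hs m `^ (s - 2^-1) <= delta / 4.
  have sg0 : 0 < s - 2^-1 by rewrite subr_gt0.
  pose y := (delta / 4 / (W + 1)) `^ (s - 2^-1)^-1.
  have W1 : 0 < W + 1 by lra.
  have y0 : 0 < y by rewrite powR_gt0// !divr_gt0.
  exists (Num.truncn ((b - 1) / y)).
  have hy : hs (Num.truncn ((b - 1) / y)) <= y.
    rewrite /hs ler_pdivrMr// mulrC -ler_pdivrMr//.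
    by rewrite ltW// truncnS_gt.
  have : hs (Num.truncn ((b - 1) / y)) `^ (s - 2^-1) <= delta / 4 / (W + 1).
    apply: (@le_trans _ _ (y `^ (s - 2^-1))).
      by apply: ge0_ler_powR; rewrite ?nnegrE ?(ltW sg0) ?(ltW y0)// ltW.
    by rewrite /y -powRrM mulVf ?gt_eqF// powRr1// !divr_ge0// ltW.
  move=> /(ler_wpM2l W0)/le_trans; apply.
  rewrite mulrCA ler_piMr ?divr_ge0 ?(ltW d0)// ler_pdivrMr// mul1r lerDl//.
have oscm i : osc k i m <= delta / 4.
  apply: le_trans hm; rewrite /osc /W mulrAC.
  rewrite ler_wpM2r ?powR_ge0// ler_wpM2l// ler_wpM2r//.
  rewrite eneg !powRN lef_pV2 ?posrE ?powR_gt0//.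
  by apply: ge0_ler_powR; rewrite ?nnegrE// ltW.
pose idx := [seq (k, i, m, t) | i <- iota 0 i0, t <- iota 0 m.+1].
have : \forall n \near \oo, forall q, q \in idx -> `|A (phi n) q - L q| <= delta / 4.
  apply: near_forall_seq => q _.
  have /cvgrPdist_le/(_ (delta / 4)) := hL q.
  rewrite divr_gt0// => /(_ isT); apply: filterS => n; by rewrite distrC.
move=> [n0 _ hn0]; exists n0 => n n' n0n n0n'.
have key i t : (t <= m)%N -> {ae mu, forall x, piece m t (dil (lam k i)^-1 x) ->
   (i < i0)%N -> `|un (phi n) x - un (phi n') x| <= delta}.
  move=> tm; have li0 : 0 < (lam k i)^-1 by rewrite invr_gt0.
  have h1 := ae_dil mu_leb li0 (hA (phi n) k i m t tm).
  have h2 := ae_dil mu_leb li0 (hA (phi n') k i m t tm).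
  apply: filterS2 h1 h2 => x h1 h2 Px ii0.
  have {h1} := h1 Px; have {h2} := h2 Px.
  rewrite dil_dil divff ?gt_eqF// dil1.
  set q := (k, i, m, t) => h2 h1.
  have qi : q \in idx by apply/allpairsP; exists (i, t); rewrite !mem_iota/= ltnS.
  have := hn0 n n0n q qi; have := hn0 n' n0n' q qi.
  rewrite -!/q; move: (oscm i) h1 h2.
  move: (un (phi n) x) (un (phi n') x) (A (phi n) q) (A (phi n') q) (L q) => a c a' c' l.
  move=> h0; rewrite !ler_norml => /andP[? ?] /andP[? ?] /andP[? ?] /andP[? ?].
  by apply/andP; split; lra.
have key' : {ae mu, forall x, forall i t, (t <= m)%N -> piece m t (dil (lam k i)^-1 x) ->
   (i < i0)%N -> `|un (phi n) x - un (phi n') x| <= delta}.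
  apply: ae_foralln => i; apply: ae_foralln => t.
  have [tm|tm] := leqP t m; last by apply: nearW.
  by apply: filterS (key i t tm) => x + _; exact.
apply: filterS key' => x hx /andP[rx xr'].
have x0 : lam k 0 <= enorm x by exact: le_trans rx.
have [i [ii0 li1 li2]] : exists i, [/\ (i < i0)%N, lam k i <= enorm x & enorm x < lam k i.+1].
  have ex : exists i, enorm x < lam k i by exists i0; exact: lt_le_trans hi0.
  case: (ex_minnP ex) => -[|i] hi mini; first by move: hi; rewrite ltNge x0.
  exists i; split=> //.
    by apply: mini; exact: lt_le_trans hi0.
  by rewrite leNgt; apply/negP => /mini; rewrite ltnn.
pose y := dil (lam k i)^-1 x.
have y1 : 1 <= enorm y by rewrite /y enorm_dil gtr0_norm ?invr_gt0// ler_pdivlMl// mulr1.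
have y2 : enorm y < 2.
  by rewrite /y enorm_dil gtr0_norm ?invr_gt0// ltr_pdivrMl// mulrC -lamS.
have Y1 : 1 <= enorm y ^+ N by rewrite exprn_ege1.
have Y2 : enorm y ^+ N < b.
  by rewrite /b ltr_pXn2r ?nnegrE ?enorm_ge0.
(* Position of [|y|^N] in the base shell counted in pieces; its integer part is the index [t]. *)
pose z := (enorm y ^+ N - 1) / hs m.
have z0 : 0 <= z by rewrite divr_ge0 ?subr_ge0// ltW.
have /andP[tz1 tz2] := truncn_itv z0.
apply: (hx i (Num.truncn z)) => //.
  rewrite -ltnS -(ltr_nat R) (le_lt_trans tz1)// /z /hs invf_div mulrA ltr_pdivrMr ?subr_gt0//.
  by rewrite mulrC ltr_pM2l// ltrD2r.
rewrite /piece/shell/= -/y; apply/andP; split.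
  by rewrite -lerBrDl -ler_pdivlMr.
rewrite -addrA -ltrBlDl -[X in _ < _ + X]mul1r -mulrDl natr1 -ltr_pdivrMr//.
Qed.

End LocalCompactness.

(** * The normalizing constant *)

Lemma norm_sin_le {R : realType} (x : R) : `|sin x| <= `|x|.
Proof.
wlog x0 : x / 0 <= x.
  move=> h; have [|x0] := leP 0 x; first exact: h.
  by rewrite -normrN -sinN -[leRHS]normrN; apply: h; rewrite oppr_ge0 ltW.
have [] := @MVT_segment R sin cos 0 x x0.
  by apply: continuous_subspaceT => y; exact: continuous_sin.
by move=> c _; rewrite sin0 !subr0 => ->; rewrite normrM ler_piMl// cos_max.
Qed.

Lemma subr_cos_le {R : realType} (x : R) : 1 - cos x <= x ^+ 2.
Proof.
pose y := x / 2; have xy : x = y *+ 2 by rewrite -mulr_natr /y divfK.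
have -> : x ^+ 2 = 4 * y ^+ 2 by rewrite /y; field.
rewrite xy cos_mulr2n.
have -> : 1 - (cos y ^+ 2 *+ 2 - 1) = 2 * sin y ^+ 2.
  by rewrite sin2cos2 -mulr_natr; ring.
have h : sin y ^+ 2 <= y ^+ 2.
  rewrite -[leLHS]real_normK ?num_real// -[leRHS]real_normK ?num_real//.
  by apply: lerXn2r; rewrite ?nnegrE//; exact: norm_sin_le.
by have := sqr_ge0 y; lra.
Qed.

Section NormalizingConstant.
Context {R : realType} {N : nat}.
Variable mu : {measure set (RN R N) -> \bar R}.
Hypothesis mu_leb : is_lebesgue mu.
Hypothesis N_gt0 : (0 < N)%N.
Variable s : R.
Hypotheses (s_gt0 : 0 < s) (s_lt1 : s < 1).

Let P : R := N%:R + 2 * s.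
Let i0 : 'I_N := Ordinal N_gt0.
Let om := omega mu.
Let om_gt0 : 0 < om. Proof. exact: omega_gt0. Qed.

Let f (z : RN R N) : R := (1 - cos (z i0)) / (enorm z `^ P).

Let f_ge0 z : 0 <= f z.
Proof. by rewrite divr_ge0 ?powR_ge0// subr_ge0 cos_le1. Qed.

Let mf : measurable_fun setT (fun z => (f z)%:E).
Proof.
apply/measurable_EFinP.
rewrite (_ : f = (fun z : RN R N => (1 - cos (z i0)) * (enorm z `^ (- P)))); last first.
  by apply/funext => z; rewrite powRN.
apply: measurable_funM.
  apply: measurable_funB => //.
  apply: (@measurableT_comp _ _ _ _ _ _ (@cos R) _ (fun z : RN R N => z i0)).
    by apply: continuous_measurable_fun; exact: continuous_cos.
  exact: measurable_coord.
apply: (@measurableT_comp _ _ _ _ _ _ (@powR R ^~ (- P)) _ (fun z : RN R N => enorm z)).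
  exact: measurable_powR.
exact: measurable_enorm_RN.
Qed.

Let P_gt0 : 0 < P. Proof. by rewrite addr_gt0 ?ltr0n// mulr_gt0. Qed.

Let dyad (l : R) : set (RN R N) := shell (l ^+ N) ((2 * l) ^+ N).

Let int_dyad l M : 0 < l -> (forall z, dyad l z -> f z <= M) -> 0 <= M ->
  (\int[mu]_(z in dyad l) (f z)%:E <= (M * (om * (2 * l) ^+ N))%:E)%E.
Proof.
move=> l0 fM M0.
have mD : measurable (dyad l) by exact: measurable_shell.
apply: (@le_trans _ _ (\int[mu]_(z in dyad l) (cst M%:E z))%E).
  apply: ge0_le_integral => //.
  - by move=> z _; rewrite lee_fin.
  - exact: measurable_funTS.
have l2 : 0 <= l ^+ N by rewrite exprn_ge0// ltW.
rewrite integral_cst// mu_shell//; last first.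
  apply: lerXn2r; rewrite ?nnegrE ?(ltW l0)// ?mulr_ge0 ?(ltW l0)//.
  by rewrite ler_peMl ?(ltW l0)// ler1n.
rewrite -EFinM lee_fin ler_wpM2l// ler_pM2l// gerBl//.
Qed.

Let dyad_enorm l z : 0 < l -> dyad l z -> l <= enorm z /\ enorm z < 2 * l.
Proof.
move=> l0 /andP[]; rewrite ler_pXn2r ?nnegrE ?enorm_ge0 ?(ltW l0)//.
by rewrite ltr_pXn2r ?nnegrE ?enorm_ge0 ?mulr_ge0 ?(ltW l0).
Qed.

Let powRD2 (l : R) : 0 < l -> l `^ P = l ^+ N * l `^ (2 * s).
Proof.
move=> l0; rewrite /P powRD ?powR_mulrn ?(ltW l0)//.
by apply/implyP => _; rewrite gt_eqF.
Qed.

(** Ratios of two geometric series over dyadic shells: [q1] for large [|z|], from [1 - cos <= 2] and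
    [s > 0], and [q2] for small [|z|], from [1 - cos t <= t^2] and [s < 1]. *)
Let q1 : R := 2 `^ (- (2 * s)).
Let q2 : R := 2 `^ (- (2 * (1 - s))).
Let q1_ge0 : 0 <= q1. Proof. exact: powR_ge0. Qed.
Let q2_ge0 : 0 <= q2. Proof. exact: powR_ge0. Qed.
Let q1_lt1 : q1 < 1. Proof. by rewrite powR2N_lt1// mulr_gt0. Qed.
Let q2_lt1 : q2 < 1. Proof. by rewrite powR2N_lt1// mulr_gt0// subr_gt0. Qed.
(** On the shell [l <= |z| < 2 l] the numerator is at most 2 far out and [(2 l)^2] near 0, whence
    the 2 here and the 4 in [cd']; the rest comes from the volume bound [om * (2 l) ^ N]. *)
Let cd : R := 2 * om * 2 ^+ N.
Let cd_ge0 : 0 <= cd. Proof. by rewrite !mulr_ge0// ?ltW// exprn_ge0. Qed.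
Let cd' : R := 4 * om * 2 ^+ N.
Let cd'_ge0 : 0 <= cd'. Proof. by rewrite !mulr_ge0// ?ltW// exprn_ge0. Qed.

Let pow2X (t : R) (n : nat) : (2 `^ t) ^+ n = (2 ^+ n) `^ t :> R.
Proof.
by rewrite -powR_mulrn ?powR_ge0// -powRrM mulrC powRrM powR_mulrn.
Qed.

Let int_out n : (\int[mu]_(z in dyad (2 ^+ n)) (f z)%:E <= (cd * q1 ^+ n)%:E)%E.
Proof.
set l : R := 2 ^+ n; have l0 : 0 < l by rewrite exprn_gt0.
have lP := powRD2 l0.
have lN : 0 < l ^+ N by rewrite exprn_gt0.
have l2s : 0 < l `^ (2 * s) by rewrite powR_gt0.
apply: le_trans (@int_dyad l (2 / l `^ P) l0 _ _) _.
- move=> z /(dyad_enorm l0)[z1 z2].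
  have z0 : 0 < enorm z by exact: lt_le_trans z1.
  rewrite /f ler_pM ?invr_ge0 ?powR_ge0 ?subr_ge0 ?cos_le1//.
    by have := cos_geN1 (z i0); lra.
  rewrite lef_pV2 ?posrE ?powR_gt0//.
  by apply: ge0_ler_powR; rewrite ?nnegrE ?(ltW P_gt0) ?(ltW l0) ?(ltW z0).
- by rewrite divr_ge0 ?powR_ge0.
rewrite lee_fin /cd /q1 pow2X -/l powRN lP exprMn.
rewrite le_eqVlt; apply/orP; left; apply/eqP; field.
by rewrite !gt_eqF.
Qed.

Let int_in n : (\int[mu]_(z in dyad (2 ^- n.+1)) (f z)%:E <= (cd' * q2 ^+ n.+1)%:E)%E.
Proof.
set l : R := 2 ^- n.+1; have l0 : 0 < l by rewrite invr_gt0 exprn_gt0.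
have lP := powRD2 l0.
have lN : 0 < l ^+ N by rewrite exprn_gt0.
have l2s : 0 < l `^ (2 * s) by rewrite powR_gt0.
apply: le_trans (@int_dyad l ((2 * l) ^+ 2 / l `^ P) l0 _ _) _.
- move=> z /(dyad_enorm l0)[z1 z2].
  have z0 : 0 < enorm z by exact: lt_le_trans z1.
  rewrite /f ler_pM ?invr_ge0 ?powR_ge0 ?subr_ge0 ?cos_le1//.
    apply: (le_trans (subr_cos_le _)); rewrite -[leLHS]real_normK ?num_real//.
    apply: lerXn2r; rewrite ?nnegrE ?mulr_ge0 ?(ltW l0)//.
    exact: le_trans (coord_le_enorm z i0) (ltW z2).
  rewrite lef_pV2 ?posrE ?powR_gt0//.
  by apply: ge0_ler_powR; rewrite ?nnegrE ?(ltW P_gt0) ?(ltW l0) ?(ltW z0).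
- by rewrite divr_ge0 ?powR_ge0// exprn_ge0// mulr_ge0// ltW.
have q2E : q2 ^+ n.+1 = l ^+ 2 / l `^ (2 * s).
  rewrite /q2 pow2X powRN -[in RHS]/l.
  have -> : 2 ^+ n.+1 = l^-1 by rewrite invrK.
  rewrite (_ : 2 * (1 - s) = 2%:R + - (2 * s)); last by ring.
  rewrite powRD; last by apply/implyP => _; rewrite gt_eqF ?invr_gt0.
  rewrite powR_mulrn ?invr_ge0 ?(ltW l0)// powRN exprVn.
  have -> : l^-1 `^ (2 * s) = (l `^ (2 * s))^-1.
    by rewrite -powR_inv1 ?(ltW l0)// -powRrM mulN1r powRN.
  by rewrite !invfM !invrK.
rewrite lee_fin /cd' q2E lP !exprMn.
rewrite le_eqVlt; apply/orP; left; apply/eqP; field.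
by rewrite !gt_eqF.
Qed.

Let F (n : nat) : set (RN R N) := shell ((2 ^- n) ^+ N) ((2 ^+ n) ^+ N).

Let mF n : measurable (F n). Proof. exact: measurable_shell. Qed.

Let in_shell (z : RN R N) a c : 0 < a -> 0 < c ->
  shell (a ^+ N) (c ^+ N) z <-> a <= enorm z /\ enorm z < c.
Proof.
move=> a0 c0; rewrite /shell/= ler_pXn2r ?nnegrE ?enorm_ge0 ?(ltW a0)//.
rewrite ltr_pXn2r ?nnegrE ?enorm_ge0 ?(ltW c0)//.
by split=> [/andP[]|[-> ->]].
Qed.

Let Kc : R := cd / (1 - q1) + cd' * q2 / (1 - q2).

(** Passing from [n] to [n.+1] adds one dyadic shell at each end; the bound is the closed form of
    the two partial geometric sums. *)
Let int_F n : (\int[mu]_(z in F n) (f z)%:E <=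
  (cd / (1 - q1) * (1 - q1 ^+ n) + cd' * q2 / (1 - q2) * (1 - q2 ^+ n))%:E)%E.
Proof.
have p1 : 1 - q1 != 0 by rewrite gt_eqF// subr_gt0.
have p2 : 1 - q2 != 0 by rewrite gt_eqF// subr_gt0.
elim: n => [|n IH].
  have -> : F 0 = set0.
    apply/seteqP; split=> // z; rewrite /F/shell/= expr0 invr1 !expr1n.
    by move=> /andP[h1 h2]; have := le_lt_trans h1 h2; rewrite ltxx.
  by rewrite integral_set0 lee_fin !expr0 !subrr !mulr0 addr0.
have mD l : measurable (dyad l) by exact: measurable_shell.
have sub : F n.+1 `<=` F n `|` (dyad (2 ^+ n) `|` dyad (2 ^- n.+1)).
  move=> z /in_shell; rewrite invr_gt0 !exprn_gt0// => /(_ isT isT)[z1 z2].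
  have [h1|h1] := ltP (enorm z) (2 ^- n).
    right; right; apply/in_shell; rewrite ?mulr_gt0 ?invr_gt0 ?exprn_gt0//; split=> //.
    by rewrite exprS invfM mulrA divff// mul1r.
  have [h2|h2] := ltP (enorm z) (2 ^+ n).
    by left; apply/in_shell; rewrite ?invr_gt0 ?exprn_gt0.
  right; left; apply/in_shell; rewrite ?mulr_gt0 ?invr_gt0 ?exprn_gt0//; split=> //.
  by rewrite -exprS.
have fz0 z : (0 <= (f z)%:E)%E by rewrite lee_fin.
have intU (A A' : set (RN R N)) : measurable A -> measurable A' ->
    (\int[mu]_(z in A `|` A') (f z)%:E <=
     \int[mu]_(z in A) (f z)%:E + \int[mu]_(z in A') (f z)%:E)%E.
  move=> mA mA'; have -> : A `|` A' = A `|` (A' `\` A).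
    apply/seteqP; split=> z [Az|Az]; try by left.
      by have [|] := pselect (A z); [left|right].
    by right; case: Az.
  rewrite ge0_integral_setU//.
  - apply: leeD => //; apply: ge0_subset_integral => //.
    + by apply: measurableD.
    + exact: measurable_funTS.
  - by apply: measurableD.
  - exact: measurable_funTS.
  - by apply/disj_set2P; rewrite setDE setICA setICr setI0.
apply: (@le_trans _ _ (\int[mu]_(z in F n `|` (dyad (2 ^+ n) `|` dyad (2 ^- n.+1))) (f z)%:E)%E).
  apply: ge0_subset_integral => //; last exact: measurable_funTS.
  by apply: measurableU => //; exact: measurableU.
apply: (le_trans (intU _ _ (mF n) (measurableU _ _ (mD _) (mD _)))).
apply: (le_trans (leeD IH (le_trans (intU _ _ (mD _) (mD _)) (leeD (int_out n) (int_in n))))).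
rewrite -!EFinD lee_fin le_eqVlt; apply/orP; left; apply/eqP.
by rewrite !exprS; field; rewrite p1 p2.
Qed.

Let bigcupF : \bigcup_n F n = ~` [set (fun=> 0) : RN R N].
Proof.
apply/seteqP; split=> z.
  move=> [n _ Fz] /= z0; move: Fz => /in_shell.
  rewrite invr_gt0 !exprn_gt0// => /(_ isT isT)[+ _].
  by rewrite z0 (enorm_eq0 _).2// leNgt invr_gt0 exprn_gt0.
move=> z0; have ez : 0 < enorm z.
  by rewrite lt_neqAle enorm_ge0 andbT eq_sym; apply/eqP => /enorm_eq0.
have le_2X (q : nat) : q%:R <= 2 ^+ q :> R by rewrite -natrX ler_nat ltnW// ltn_expl.
pose n := maxn (Num.truncn (enorm z)).+1 (Num.truncn (enorm z)^-1).+1.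
exists n => //; apply/in_shell; rewrite ?invr_gt0 ?exprn_gt0//; split.
  rewrite -[leRHS]invrK lef_pV2 ?posrE ?invr_gt0 ?exprn_gt0//.
  apply: (le_trans (ltW (truncnS_gt _))); apply: le_trans (le_2X _).
  by rewrite ler_nat leq_maxr.
apply: (lt_le_trans (truncnS_gt _)); apply: le_trans (le_2X _).
by rewrite ler_nat leq_maxl.
Qed.

Let int_f_le : (\int[mu]_z (f z)%:E <= Kc%:E)%E.
Proof.
have fz0 z : (0 <= (f z)%:E)%E by rewrite lee_fin.
have -> : (\int[mu]_z (f z)%:E = \int[mu]_(z in \bigcup_n F n) (f z)%:E)%E.
  rewrite bigcupF [RHS]integral_mkcond; apply: eq_integral => z _.
  rewrite patchE; case: ifPn => // /negP; rewrite inE/= => /contrapT ->.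
  by rewrite /f cos0 subrr mul0r.
have nd : nondecreasing_seq F.
  apply/nondecreasing_seqP => n; apply/subsetPset => z /in_shell.
  rewrite invr_gt0 !exprn_gt0// => /(_ isT isT)[h1 h2].
  apply/in_shell; rewrite ?invr_gt0 ?exprn_gt0//; split.
    by apply: le_trans h1; rewrite lef_pV2 ?posrE ?exprn_gt0// exprS ler_peMl ?exprn_ge0 ?ler1n.
  by apply: (lt_le_trans h2); rewrite exprS ler_peMl ?exprn_ge0 ?ler1n.
have cv := @ge0_nondecreasing_set_cvg_integral _ _ R F (fun z => (f z)%:E) mu nd mF
  (fun i => measurable_funTS mf) (fun i x _ => fz0 x).
rewrite -(cvg_lim _ cv)//; apply: lime_le; first by apply/cvg_ex; eexists; exact: cv.
apply: nearW => n; apply: (le_trans (int_F n)); rewrite lee_fin /Kc.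
apply: lerD.
  by rewrite ler_piMr ?gerBl ?exprn_ge0// divr_ge0// subr_ge0 ltW.
rewrite ler_piMr ?gerBl ?exprn_ge0//.
by apply: divr_ge0; [exact: mulr_ge0|rewrite subr_ge0 ltW].
Qed.

Let int_f_gt0 : (0 < \int[mu]_z (f z)%:E)%E.
Proof.
have fz0 z : (0 <= (f z)%:E)%E by rewrite lee_fin.
rewrite lt_neqAle integral_ge0// andbT eq_sym; apply/eqP => int0.
have := @ge0_integral_eq0_ae _ _ _ mu setT (fun z => (f z)%:E) measurableT mf (fun z _ => fz0 z).
rewrite int0 => /(_ (lexx _)) h.
pose Q : set (RN R N) := box (fun=> 2^-1) (fun=> 1).
have mQ : measurable Q by exact: measurable_box.
have muQ : (0 < mu Q)%E.
  rewrite /Q mu_leb; last by move=> _; rewrite invf_le1// ler1n.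
  by rewrite lte_fin prodr_gt0// => i _; rewrite subr_gt0 invf_lt1// ltr1n.
have [z Qz /(_ I)] := ae_exists mQ muQ h.
have /andP[z1 z2] := Qz i0.
have z0 : 0 < z i0 by rewrite (lt_le_trans _ z1).
have ez : 0 < enorm z.
  by rewrite (lt_le_trans z0)// (le_trans (ler_norm _))// coord_le_enorm.
have cz : cos (z i0) < 1.
  rewrite -cos0 ltr_cos// in_itv/= ?lexx ?pi_ge0//.
  by rewrite (ltW z0) (le_trans z2)// (le_trans _ (pi_ge2 R))// ler1n.
move=> /eqP; rewrite eqe gt_eqF// /f divr_gt0 ?powR_gt0// subr_gt0//.
Qed.

(** [fine] sends [+oo] to 0 and the inverse of 0 is 0, so positivity requires the integral to be
    finite as well as positive. *)
Lemma CNs_gt0 : 0 < CNs mu s.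
Proof.
have E : (\int[mu]_z (((1 - cos (\sum_(i < N | (i : nat) == 0%N) z i))
      / (enorm z `^ (N%:R + 2 * s)))%R)%:E = \int[mu]_z (f z)%:E)%E.
  apply: eq_integral => z _; rewrite /f (big_pred1 i0)//.
rewrite /CNs E invr_gt0 fine_gt0// int_f_gt0/=.
by rewrite (le_lt_trans int_f_le)// ltry.
Qed.

End NormalizingConstant.

(** * Weighted integrals *)

Lemma limn_esup_le_cst {R : realType} (u : (\bar R)^nat) (B : \bar R) :
  (forall n, (u n <= B)%E) -> (limn_esup u <= B)%E.
Proof.
move=> uB; rewrite limn_esup_lim; apply: lime_le; first exact: is_cvg_esups.
by apply: nearW => n; apply: ge_ereal_sup => _ [k _ <-].
Qed.

Lemma ge0_integral_le_of_ae_cvg {d : measure_display} {T : measurableType d}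
    {R : realType} (mu : {measure set T -> \bar R}) (D : set T)
    (f : (T -> \bar R)^nat) (h : T -> \bar R) (B : \bar R) :
  measurable D -> (forall n, measurable_fun D (f n)) -> measurable_fun D h ->
  (forall n x, D x -> (0 <= f n x)%E) -> (forall x, D x -> (0 <= h x)%E) ->
  {ae mu, forall x, D x -> f n x @[n --> \oo] --> h x} ->
  (forall n, (\int[mu]_(x in D) f n x <= B)%E) -> (\int[mu]_(x in D) h x <= B)%E.
Proof.
move=> mD mf mh f0 h0 fh fB.
have mlim : measurable_fun D (fun x => limn_esup (f^~ x)) by exact: measurable_fun_limn_esup.
have einf_esup : {ae mu, forall x, D x -> limn_esup (f^~ x) = h x /\ limn_einf (f^~ x) = h x}.
  by apply: filterS fh => x fx Dx; have [-> ->] := cvg_limn_einf_sup (fx Dx).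
have meinf : measurable_fun D (fun x => limn_einf (f^~ x)).
  rewrite (_ : (fun x => _) = (fun x => - limn_esup (fun n => - f n x))%E); last first.
    by apply/funext => x; rewrite -limn_einfN; congr limn_einf; apply/funext => n /=; rewrite oppeK.
  apply: measurableT_comp; first exact: oppe_measurable.
  apply: measurable_fun_limn_esup => n.
  by apply: measurableT_comp; [exact: oppe_measurable|exact: mf].
apply: (@le_trans _ _ (\int[mu]_(x in D) limn_einf (f^~ x))%E).
  rewrite le_eqVlt; apply/orP; left; apply/eqP; apply: ae_eq_integral => //.
  by apply: filterS einf_esup => x + Dx => /(_ Dx)[].
apply: (le_trans (fatou mu mD mf f0)).
exact: le_trans (limn_einf_sup _) (limn_esup_le_cst fB).
Qed.

Lemma measurable_radial_weight {R : realType} {N : nat} (W : R -> R) :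
  (forall r, 0 < r -> {for r, continuous W}) ->
  measurable_fun setT (fun x : RN R N => W (enorm x)).
Proof.
move=> cW.
(* Continuity is known on []0, +oo[] only. The norm is nonnegative, so [W] may be frozen at [W 0] on
   the other half line without changing the composition. *)
pose W' (r : R) := if 0 < r then W r else W 0.
rewrite (_ : (fun x => _) = (fun x : RN R N => W' (enorm x))); last first.
  apply/funext => x; rewrite /W'; case: ltP => // x0.
  by congr W; apply/eqP; rewrite eq_le x0 enorm_ge0.
have mW' : measurable_fun setT W'.
  have -> : [set: R] = `]0, +oo[ `|` `]-oo, 0].
    apply/seteqP; split=> // r _.
    by have [r0|r0] := ltP 0 r; [left|right]; rewrite /= in_itv/= ?r0.
  apply/measurable_funU => //; split.
    apply: (@eq_measurable_fun _ _ _ _ _ W).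
      by move=> r; rewrite inE/= in_itv/= andbT /W' => ->.
    apply: open_continuous_measurable_fun; first exact: interval_open.
    by move=> r; rewrite inE/= in_itv/= andbT => /cW.
  apply: (@eq_measurable_fun _ _ _ _ _ (cst (W 0))).
    by move=> r; rewrite inE/= in_itv/= /W' ltNge => ->.
  exact: measurable_cst.
apply: (@measurableT_comp _ _ _ _ _ _ W' _ (fun x : RN R N => enorm x)) => //.
exact: measurable_enorm_RN.
Qed.

Section WeightedIntegral.
Context {R : realType} {N : nat}.
Variable mu : {measure set (RN R N) -> \bar R}.
Hypothesis mu_leb : is_lebesgue mu.
Hypothesis N_gt0 : (0 < N)%N.
Variable K : R -> R.
Hypothesis cK : forall r, 0 < r -> {for r, continuous K}.
Hypothesis K_ge0 : forall r, 0 < r -> 0 <= K r.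

Definition wint (q : R) (D : set (RN R N)) (f : RN R N -> R) : \bar R :=
  (\int[mu]_(x in D) (K (enorm x) * `|f x| `^ q)%:E)%E.

(* The weight is only constrained on ]0,+oo[ : its value at 0 is discarded. *)
Let Kp (r : R) : R := if 0 < r then K r else 0.

Let wpos q (f : RN R N -> R) (x : RN R N) : \bar R := (Kp (enorm x) * `|f x| `^ q)%:E.

Let wpos_ge0 q f x : (0 <= wpos q f x)%E.
Proof.
by rewrite lee_fin mulr_ge0 ?powR_ge0// /Kp; case: ifP => // /K_ge0.
Qed.

Lemma ae_enorm_gt0 : {ae mu, forall x : RN R N, 0 < enorm x}.
Proof.
exists [set (fun=> 0)]; split; [|exact: mu_zero|].
  have -> : [set (fun=> 0) : RN R N] = box (fun=> 0) (fun=> 0).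
    apply/seteqP; split=> [x -> i|x h]; first by rewrite lexx.
    by apply/funext => i; apply/eqP; rewrite eq_le andbC; exact: h.
  exact: measurable_box.
move=> x /= /negP; rewrite lt_neqAle enorm_ge0 andbT negbK eq_sym => /eqP.
by move/enorm_eq0.
Qed.

Let mpow q (f : RN R N -> R) : measurable_fun setT f ->
  measurable_fun setT (fun x => `|f x| `^ q).
Proof.
move=> mf; apply: (@measurableT_comp _ _ _ _ _ _ (@powR R ^~ q) _ (fun x => `|f x|)).
  exact: measurable_powR.
by apply: measurableT_comp => //; exact: normr_measurable.
Qed.

Let mwpos q f : measurable_fun setT f -> measurable_fun setT (wpos q f).
Proof.
move=> mf; apply/measurable_EFinP; apply: measurable_funM; last exact: mpow.
apply: measurable_radial_weight => r r0.
have cKr : K y @[y --> r] --> K r by exact: cK.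
suff : Kp y @[y --> r] --> Kp r by [].
rewrite [X in _ --> X](_ : Kp r = K r); last by rewrite /Kp r0.
apply: cvg_trans cKr; apply: near_eq_cvg.
near=> y; rewrite /Kp ifT//; near: y.
exact: lt_nbhsr.
Unshelve. all: by end_near. Qed.

Let wintE q D f : measurable D -> measurable_fun setT f ->
  wint q D f = (\int[mu]_(x in D) wpos q f x)%E.
Proof.
move=> mD mf; apply: ae_eq_integral => //.
- apply: measurable_funTS; apply/measurable_EFinP; apply: measurable_funM.
    exact: measurable_radial_weight.
  exact: mpow.
- by apply: measurable_funTS; exact: mwpos.
by apply: filterS ae_enorm_gt0 => x x0 _; rewrite /wpos /Kp x0.
Qed.

Lemma wint_ge0 q D f : measurable D -> measurable_fun setT f -> (0 <= wint q D f)%E.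
Proof. by move=> mD mf; rewrite wintE//; apply: integral_ge0 => x _; exact: wpos_ge0. Qed.

Lemma wint_setU q D E f : measurable D -> measurable E -> [disjoint D & E] ->
  measurable_fun setT f -> wint q (D `|` E) f = (wint q D f + wint q E f)%E.
Proof.
move=> mD mE DE mf.
rewrite (wintE _ mD mf) (wintE _ mE mf) (wintE _ (measurableU _ _ mD mE) mf).
by apply: ge0_integral_setU => //; apply: measurable_funTS; exact: mwpos.
Qed.

Lemma wint_scale q D f (c : R) : measurable D -> measurable_fun setT f -> 0 <= c ->
  wint q D (fun x => c * f x) = ((c `^ q)%:E * wint q D f)%E.
Proof.
move=> mD mf c0; rewrite !wintE//; last exact: measurable_funM.
rewrite -ge0_integralZl_EFin ?powR_ge0//; last by apply: measurable_funTS; exact: mwpos.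
apply: eq_integral => x _; rewrite /wpos -EFinM; congr (_)%:E.
by rewrite normrM (ger0_norm c0) powRM// mulrCA.
Qed.

Lemma wint_ae_le q D (f g : RN R N -> R) : 0 <= q -> measurable D -> measurable_fun setT f ->
  measurable_fun setT g -> {ae mu, forall x, D x -> `|f x| <= `|g x|} ->
  (wint q D f <= wint q D g)%E.
Proof.
move=> q0 mD mf mg fg; rewrite (wintE q mD mf) (wintE q mD mg).
apply: ae_ge0_le_integral => //.
- by apply: measurable_funTS; exact: mwpos.
- by apply: measurable_funTS; exact: mwpos.
apply: filterS fg => x fg Dx; rewrite lee_fin ler_wpM2l//.
  by rewrite /Kp; case: ifP => // /K_ge0.
by apply: ge0_ler_powR; rewrite ?nnegrE//; exact: fg.
Qed.

Lemma wint_quadratic_sub (f g : RN R N -> R) D : measurable D -> measurable_fun setT f ->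
  measurable_fun setT g ->
  (wint 2%:R D (fun x => f x - g x)%R <= 2%:E * (wint 2%:R D f + wint 2%:R D g))%E.
Proof.
move=> mD mf mg; have mfg : measurable_fun setT (fun x => f x - g x) by exact: measurable_funB.
rewrite (wintE _ mD mf) (wintE _ mD mg) (wintE _ mD mfg).
have mwf : measurable_fun D (wpos 2%:R f) by apply: measurable_funTS; exact: mwpos.
have mwg : measurable_fun D (wpos 2%:R g) by apply: measurable_funTS; exact: mwpos.
rewrite -ge0_integralD// -ge0_integralZl_EFin//; last 2 first.
- by move=> x _; rewrite adde_ge0.
- exact: emeasurable_funD.
apply: ge0_le_integral => //.
- by apply: measurable_funTS; apply: mwpos; exact: measurable_funB.
- by apply: measurable_funeM; exact: emeasurable_funD.
move=> x _; rewrite /wpos -EFinD -EFinM lee_fin -mulrDr mulrCA ler_wpM2l//.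
  by rewrite /Kp; case: ifP => // /K_ge0.
rewrite !powR_mulrn// !real_normK ?num_real//.
have := sqr_ge0 (f x + g x); nra.
Qed.

Lemma wint_le_of_ae_cvg q D (f : nat -> RN R N -> R) (h : RN R N -> R) B : 0 <= q -> measurable D ->
  (forall n, measurable_fun setT (f n)) -> measurable_fun setT h ->
  {ae mu, forall x, f n x @[n --> \oo] --> h x} ->
  (forall n, (wint q D (f n) <= B)%E) -> (wint q D h <= B)%E.
Proof.
move=> q0 mD mf mh fh fB; rewrite wintE//.
apply: (@ge0_integral_le_of_ae_cvg _ _ _ mu D (fun n => wpos q (f n))) => //.
- by move=> n; apply: measurable_funTS; exact: mwpos.
- by apply: measurable_funTS; exact: mwpos.
- apply: filterS fh => x fx _; apply: cvg_EFin; first by apply: nearW.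
  rewrite (_ : fine \o _ = (fun n => Kp (enorm x) * `|f n x| `^ q)); last first.
    by apply/funext.
  apply: cvgMr; move: q0; rewrite le_eqVlt => /orP[/eqP <-|q0].
    under eq_fun do rewrite powRr0; rewrite powRr0; exact: cvg_cst.
  have cn : `|f n x| @[n --> \oo] --> `|h x| by exact: cvg_norm.
  have [h0|h0] := eqVneq (h x) 0.
    rewrite h0 normr0 powR0 ?gt_eqF//; rewrite h0 normr0 in cn.
    apply/cvgrPdist_lt => e e0.
    have eq0 : 0 < e `^ q^-1 by rewrite powR_gt0.
    move/cvgrPdist_lt/(_ _ eq0): cn; apply: filterS => n.
    rewrite !sub0r !normrN normr_id (ger0_norm (powR_ge0 _ _)) => hn.
    have := @gt0_ltr_powR R q q0 `|f n x| (e `^ q^-1).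
    rewrite !nnegrE normr_ge0 powR_ge0 => /(_ isT isT hn).
    by rewrite -powRrM mulVf ?gt_eqF// powRr1// ltW.
  have hp : 0 < `|h x| by rewrite normr_gt0.
  have -> : `|h x| `^ q = expR (q * ln `|h x|) by rewrite /powR gt_eqF.
  have cl : expR (q * ln `|f n x|) @[n --> \oo] --> expR (q * ln `|h x|).
    have cln : ln `|f n x| @[n --> \oo] --> ln `|h x|.
      exact: (@continuous_cvg _ _ _ _ _ (fun n => `|f n x|) (@ln R) `|h x| (continuous_ln hp) cn).
    have cq : q * ln `|f n x| @[n --> \oo] --> q * ln `|h x| by exact: cvgMr.
    exact: (@continuous_cvg _ _ _ _ _ (fun n => q * ln `|f n x|) (@expR R) _ (@continuous_expR R _) cq).
  apply: cvg_trans cl; apply: near_eq_cvg.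
  near=> n; rewrite /powR gt_eqF//; near: n.
  exact: (cvgr_gt _ cn).
move=> n; rewrite -wintE//.
Unshelve. all: by end_near. Qed.

(** [kap] is the maximum of [K] on [[r, r']] times the volume of the annulus. Being chosen before
    [q], [f] and [b], it may enter the later choice of [b]. *)
Lemma wint_annulus r r' : 0 < r -> exists2 kap, 0 <= kap &
  forall q (f : RN R N -> R) b, 0 <= q -> 0 <= b -> measurable_fun setT f ->
  {ae mu, forall x : RN R N, r <= enorm x < r' -> `|f x| <= b} ->
  (wint q [set x : RN R N | (r <= enorm x < r')%R] f <= (kap * b `^ q)%:E)%E.
Proof.
move=> r0; have [rr'|r'r] := ltP r r'; last first.
  exists 0 => // q f b q0 b0 mf _.
  have -> : [set x : RN R N | (r <= enorm x < r')%R] = set0.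
    apply/seteqP; split=> // x /= /andP[h1 h2].
    by have := lt_le_trans (le_lt_trans h1 h2) r'r; rewrite ltxx.
  by rewrite /wint integral_set0 mul0r.
have [c _ hc] : exists2 c : R, c \in `[r, r'] & forall t, t \in `[r, r'] -> K t <= K c.
  apply: EVT_max; first exact: ltW.
  apply: continuous_in_subspaceT => t; rewrite inE/= in_itv/= => /andP[rt _].
  by apply: cK; exact: lt_le_trans rt.
have Kc0 : 0 <= K c.
  apply: le_trans (hc r _); first exact: K_ge0.
  by rewrite in_itv/= lexx ltW.
have r'0 : 0 < r' by exact: lt_trans rr'.
have DE : [set x : RN R N | (r <= enorm x < r')%R] = shell (r ^+ N) (r' ^+ N).
  apply/seteqP; split=> x; rewrite /shell/= ler_pXn2r ?nnegrE ?enorm_ge0 ?(ltW r0)//.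
    by rewrite ltr_pXn2r ?nnegrE ?enorm_ge0 ?(ltW r'0).
  by rewrite ltr_pXn2r ?nnegrE ?enorm_ge0 ?(ltW r'0).
have mS : measurable (shell (r ^+ N) (r' ^+ N) : set (RN R N)) by exact: measurable_shell.
have rN : 0 <= r ^+ N by rewrite exprn_ge0// ltW.
have rNr' : r ^+ N <= r' ^+ N by apply: lerXn2r; rewrite ?nnegrE ltW.
exists (K c * (omega mu * (r' ^+ N - r ^+ N))).
  rewrite mulr_ge0// mulr_ge0 ?subr_ge0// ltW//; exact: omega_gt0.
move=> q f b q0 b0 mf fb; rewrite DE wintE//.
apply: (@le_trans _ _ (\int[mu]_(x in shell (r ^+ N) (r' ^+ N)) (cst (K c * b `^ q)%:E x))%E).
  apply: ae_ge0_le_integral => //.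
  - by apply: measurable_funTS; exact: mwpos.
  - by move=> x _; rewrite lee_fin mulr_ge0// powR_ge0.
  apply: filterS fb => x fb; rewrite -DE => /= xr; have /andP[rx xr'] := xr.
  have x0 : 0 < enorm x by exact: lt_le_trans rx.
  rewrite lee_fin /Kp x0; apply: ler_pM => //; rewrite ?powR_ge0 ?K_ge0//.
    by apply: hc; rewrite in_itv/= rx ltW.
  by apply: ge0_ler_powR; rewrite ?nnegrE//; exact: fb.
rewrite integral_cst// mu_shell// -EFinM lee_fin.
by rewrite le_eqVlt; apply/orP; left; apply/eqP; ring.
Qed.

Lemma wint_restrict q (D : set (RN R N)) (f : RN R N -> R) : 0 < q -> measurable D -> measurable_fun setT f ->
  wint q setT (fun x => \1_D x * f x) = wint q D f.
Proof.
move=> q0 mD mf; rewrite /wint [RHS]integral_mkcond; apply: eq_integral => x _.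
rewrite patchE indicE; case: ifPn => xD; first by rewrite mul1r.
by rewrite mul0r normr0 powR0 ?gt_eqF// mulr0.
Qed.

(** Cutting [f] at radius [r'] gives an admissible decomposition. With the bounds written as powers
    of one number [A], both norms, and hence their maximum, are at most [A]. *)
Lemma sum_norm_le q1 q2 r' (f : RN R N -> R) A : 0 < q1 -> 0 < q2 -> 0 <= A ->
  measurable_fun setT f ->
  (wint q1 (Defs.ball0 r') f <= (A `^ q1)%:E)%E ->
  (wint q2 (~` Defs.ball0 r') f <= (A `^ q2)%:E)%E ->
  in_sum mu K q1 q2 f /\ (sum_norm mu K q1 q2 f <= A%:E)%E.
Proof.
move=> q10 q20 A0 mf h1 h2.
have mB : measurable (Defs.ball0 r' : set (RN R N)) by exact: measurable_ball0.
have mBc : measurable (~` Defs.ball0 r' : set (RN R N)) by exact: measurableC.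
have bound q (X : \bar R) : 0 < q -> (0 <= X)%E -> (X <= (A `^ q)%:E)%E -> (X `^ q^-1 <= A%:E)%E.
  move=> q0 X0 XA.
  have -> : A%:E = ((A `^ q)%:E `^ q^-1)%E.
    by rewrite poweR_EFin -powRrM mulfV ?gt_eqF// powRr1.
  apply: gt0_ler_poweR => //; rewrite ?invr_ge0 ?(ltW q0)//.
    by rewrite in_itv/= X0 leey.
  by rewrite in_itv/= leey andbT (le_trans X0).
pose f1 := (fun x => \1_(Defs.ball0 r' : set (RN R N)) x * f x).
pose f2 := (fun x => \1_(~` Defs.ball0 r' : set (RN R N)) x * f x).
have mf1 : measurable_fun setT f1 by apply: measurable_funM => //; exact: measurable_indic.
have mf2 : measurable_fun setT f2 by apply: measurable_funM => //; exact: measurable_indic.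
have E1 : LqK_int mu K q1 f1 = wint q1 (Defs.ball0 r') f by exact: wint_restrict.
have E2 : LqK_int mu K q2 f2 = wint q2 (~` Defs.ball0 r') f by exact: wint_restrict.
have L1 : in_LqK mu K q1 f1 by split; [exact: mf1|rewrite E1; exact: le_lt_trans h1 (ltry _)].
have L2 : in_LqK mu K q2 f2 by split; [exact: mf2|rewrite E2; exact: le_lt_trans h2 (ltry _)].
have ff : f = (fun x => f1 x + f2 x).
  apply/funext => x; rewrite /f1 /f2 -mulrDl !indicE in_setC.
  by case: (x \in _) => /=; rewrite ?addr0 ?add0r mul1r.
split; first by exists f1, f2; exact: And3 L1 L2 ff.
apply: (@le_trans _ _ (Order.max (LqK_norm mu K q1 f1) (LqK_norm mu K q2 f2))).
  by apply: ereal_inf_lbound; exists f1, f2; exact: And4 L1 L2 ff erefl.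
rewrite ge_max /LqK_norm E1 E2.
have b1 := bound _ _ q10 (wint_ge0 q1 mB mf) h1.
have b2 := bound _ _ q20 (wint_ge0 q2 mBc mf) h2.
by rewrite b1 b2.
Qed.

End WeightedIntegral.

(** * The radial space *)

Lemma poweR_half_le {R : realType} (X : \bar R) (t : R) : (0 <= X)%E -> 0 <= t ->
  (X `^ (2^-1)%R <= t%:E)%E = (X <= (t ^+ 2)%:E)%E.
Proof.
move=> X0 t0; rewrite poweR12_sqrt//; case: X X0 => [r| |]//=.
rewrite !lee_fin => r0.
by rewrite -(ler_pXn2r (n := 2))// ?nnegrE ?sqrtr_ge0// sqr_sqrtr.
Qed.

Section Embedding.
Context {R : realType} {N : nat}.
Variable mu : {sigma_finite_measure set (RN R N) -> \bar R}.
Hypothesis mu_leb : is_lebesgue mu.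
Hypothesis N_ge2 : (2 <= N)%N.
Variables (s : R) (V K : R -> R).
Hypotheses (s_gt2 : 2^-1 < s) (s_lt1 : s < 1).
Hypothesis cV : forall r, 0 < r -> {for r, continuous V}.
Hypothesis V_ge0 : forall r, 0 < r -> 0 <= V r.
Hypothesis cK : forall r, 0 < r -> {for r, continuous K}.
Hypothesis K_ge0 : forall r, 0 < r -> 0 <= K r.

Let N_gt0 : (0 < N)%N. Proof. exact: ltnW. Qed.
Let s_gt0 : 0 < s. Proof. exact: lt_trans s_gt2. Qed.
Let s_ltN : 2 * s < N%:R.
Proof.
have : 2 <= N%:R :> R by rewrite ler_nat.
by have := s_lt1; lra.
Qed.

Let p : R := crit_exp N s.
Let p_gt0 : 0 < p.
Proof. by rewrite /p /crit_exp divr_gt0 ?subr_gt0// mulr_gt0// ltr0n. Qed.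

Let c0 : R := CNs mu s / 2.
Let c0_gt0 : 0 < c0. Proof. by rewrite divr_gt0// CNs_gt0. Qed.

Let c0_ge0 : 0 <= c0. Proof. exact: ltW. Qed.

Let gagE (u : RN R N -> R) : gagliardo2 mu s u = (c0%:E * gag mu s u)%E. Proof. by []. Qed.

Let VpartE (u : RN R N -> R) : Vpart mu V u = wint mu V 2%:R setT u.
Proof. by apply: eq_integral => x _; rewrite powR_mulrn. Qed.

Let Vpart_ge0 (u : RN R N -> R) : measurable_fun setT u -> (0 <= Vpart mu V u)%E.
Proof. by move=> mu_; rewrite VpartE; exact: wint_ge0. Qed.

Let gagl_ge0 (u : RN R N -> R) : (0 <= gagliardo2 mu s u)%E.
Proof. by rewrite gagE mule_ge0// gag_ge0. Qed.

Let Hnorm2_ge0 (u : RN R N -> R) : measurable_fun setT u -> (0 <= Hnorm2 mu s V u)%E.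
Proof. by move=> mu_; rewrite /Hnorm2 adde_ge0// Vpart_ge0. Qed.

Lemma HsVrad_Hnorm2_fin (u : RN R N -> R) : HsVrad mu s V u -> Hnorm2 mu s V u \is a fin_num.
Proof.
move=> [mu_ _ gu Vu _]; rewrite /Hnorm2 fin_numD !ge0_fin_numE//.
  by rewrite gu Vu.
exact: Vpart_ge0.
Qed.

Lemma Hnorm_le (u : RN R N -> R) (t : R) : measurable_fun setT u -> 0 <= t ->
  (Hnorm mu s V u <= t%:E)%E = (Hnorm2 mu s V u <= (t ^+ 2)%:E)%E.
Proof. by move=> mu_ t0; rewrite /Hnorm poweR_half_le// Hnorm2_ge0. Qed.

Lemma gag_le_Hnorm (u : RN R N -> R) (t : R) : measurable_fun setT u -> 0 <= t ->
  (Hnorm mu s V u <= t%:E)%E -> (gag mu s u <= ((t / Num.sqrt c0) ^+ 2)%:E)%E.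
Proof.
move=> mu_ t0; rewrite Hnorm_le// => h.
have : (c0%:E * gag mu s u <= (t ^+ 2)%:E)%E.
  by apply: le_trans h; rewrite /Hnorm2 gagE leeDl// Vpart_ge0.
rewrite muleC -lee_pdivlMr// => /le_trans; apply.
by rewrite -EFinM lee_fin expr_div_n sqr_sqrtr// mulrC.
Qed.

Let gag_scale (u : RN R N -> R) (c : R) : measurable_fun setT u ->
  gag mu s (fun x => c * u x) = ((c ^+ 2)%:E * gag mu s u)%E.
Proof.
move=> mu_; have c2 : 0 <= c ^+ 2 by exact: sqr_ge0.
have E1 x : gagk mu s (fun x => c * u x) x = ((c ^+ 2)%:E * gagk mu s u x)%E.
  have k0 y : setT y -> (0 <= (kern s u x y)%:E)%E by rewrite lee_fin kern_ge0.
  rewrite /gagk -(ge0_integralZl_EFin mu measurableT k0 (measurable_kern_l s x mu_) c2).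
  apply: eq_integral => y _; rewrite -EFinM /kern mulrA; congr (_ / _)%:E.
  by rewrite -mulrBr normrM exprMn real_normK ?num_real.
rewrite /gag (eq_integral _ _ (fun x _ => E1 x)).
exact: (ge0_integralZl_EFin mu measurableT (fun x _ => gagk_ge0 mu s u x) (measurable_gagk mu s mu_) c2).
Qed.

Let Hnorm2_scale (u : RN R N -> R) (c : R) : measurable_fun setT u -> 0 <= c ->
  Hnorm2 mu s V (fun x => c * u x) = ((c ^+ 2)%:E * Hnorm2 mu s V u)%E.
Proof.
move=> mu_ c_0; rewrite /Hnorm2 !gagE !VpartE gag_scale// wint_scale// powR_mulrn//.
have g1 : (0 <= c0%:E * gag mu s u)%E by rewrite mule_ge0// gag_ge0.
have g2 : (0 <= wint mu V 2%:R setT u)%E by exact: wint_ge0.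
by rewrite (ge0_muleDr _ g1 g2) muleCA.
Qed.

Let mpow (u : RN R N -> R) : measurable_fun setT u ->
  measurable_fun setT (fun x => (`|u x| `^ p)%:E).
Proof.
move=> mu_; apply/measurable_EFinP; apply: (measurableT_comp (measurable_powR p)).
by apply: (measurableT_comp (@normr_measurable _ _)).
Qed.

Let HsVrad_scale (u : RN R N -> R) (c : R) : 0 <= c -> HsVrad mu s V u -> HsVrad mu s V (fun x => c * u x).
Proof.
move=> c_0 [mu_ up gu Vu ru]; split.
- exact: measurable_funM.
- rewrite (eq_integral (fun x => (c `^ p)%:E * (`|u x| `^ p)%:E)%E); last first.
    by move=> x _; rewrite -EFinM normrM (ger0_norm c_0) powRM.
  rewrite (ge0_integralZl_EFin mu measurableT (fun x _ => _) (mpow mu_) (powR_ge0 c p)).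
    by rewrite lte_mul_pinfty// lee_fin powR_ge0.
  by move=> x _; rewrite lee_fin powR_ge0.
- rewrite gagE gag_scale// muleCA lte_mul_pinfty// lee_fin sqr_ge0//.
- by rewrite VpartE wint_scale// lte_mul_pinfty ?lee_fin ?powR_ge0// -VpartE.
by move=> x y xy; rewrite (ru _ _ xy).
Qed.

Let gag_sub (u v : RN R N -> R) : measurable_fun setT u -> measurable_fun setT v ->
  (gag mu s (fun x => u x - v x)%R <= 2%:E * (gag mu s u + gag mu s v))%E.
Proof.
move=> mu_ mv.
have muv : measurable_fun setT (fun x => u x - v x) by exact: measurable_funB.
have k0 (w : RN R N -> R) (x y : RN R N) : setT y -> (0 <= (kern s w x y)%:E)%E.
  by rewrite lee_fin kern_ge0.
have g0 (w : RN R N -> R) (x : RN R N) : setT x -> (0 <= gagk mu s w x)%E by rewrite gagk_ge0.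
have E1 x : (gagk mu s (fun x => u x - v x)%R x <= 2%:E * (gagk mu s u x + gagk mu s v x))%E.
  have mku := measurable_kern_l s x mu_; have mkv := measurable_kern_l s x mv.
  rewrite /gagk -(ge0_integralD mu measurableT (k0 u x) mku (k0 v x) mkv).
  rewrite -(ge0_integralZl_EFin mu measurableT _ (emeasurable_funD mku mkv) (ler0n R 2)); last first.
    by move=> y _; rewrite adde_ge0// k0.
  apply: (ge0_le_integral mu measurableT (k0 _ x) (measurable_kern_l s x muv)).
    by apply: measurable_funeM; exact: emeasurable_funD.
  move=> y _; rewrite -EFinD -EFinM lee_fin /kern -mulrDl mulrA.
  rewrite ler_wpM2r ?invr_ge0 ?powR_ge0// !real_normK ?num_real//.
  by have := sqr_ge0 ((u x - u y) + (v x - v y)); nra.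
have mgu := measurable_gagk mu s mu_; have mgv := measurable_gagk mu s mv.
rewrite /gag -(ge0_integralD mu measurableT (g0 u) mgu (g0 v) mgv).
rewrite -(ge0_integralZl_EFin mu measurableT _ (emeasurable_funD mgu mgv) (ler0n R 2)); last first.
  by move=> x _; rewrite adde_ge0// g0.
apply: (ge0_le_integral mu measurableT (g0 _) (measurable_gagk mu s muv)).
  by apply: measurable_funeM; exact: emeasurable_funD.
by move=> x _; exact: E1.
Qed.

(** The pointwise inequality [(a - b)^2 <= 2 a^2 + 2 b^2], integrated in both parts of the norm,
    takes the place of the triangle inequality. *)
Lemma Hnorm2_sub (u v : RN R N -> R) : measurable_fun setT u -> measurable_fun setT v ->
  (Hnorm2 mu s V (fun x => u x - v x)%R <= 2%:E * (Hnorm2 mu s V u + Hnorm2 mu s V v))%E.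
Proof.
move=> mu_ mv; rewrite /Hnorm2 !gagE !VpartE.
have hg : (c0%:E * gag mu s (fun x => u x - v x)%R <=
    2%:E * (c0%:E * gag mu s u + c0%:E * gag mu s v))%E.
  rewrite -ge0_muleDr ?gag_ge0// muleCA lee_wpmul2l//.
  exact: gag_sub.
have hV := wint_quadratic_sub mu_leb N_gt0 cV V_ge0 measurableT mu_ mv.
apply: (le_trans (leeD hg hV)).
have g_ge0 w : (0 <= c0%:E * gag mu s w)%E by rewrite mule_ge0// gag_ge0.
have w_ge0 w : measurable_fun setT w -> (0 <= wint mu V 2%:R setT w)%E.
  by move=> mw; exact: wint_ge0.
rewrite -ge0_muleDr; first by rewrite addeACA.
- by rewrite adde_ge0.
- by rewrite adde_ge0 ?w_ge0.
Qed.

Lemma HsVrad_sub (u v : RN R N -> R) : HsVrad mu s V u -> HsVrad mu s V v ->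
  HsVrad mu s V (fun x => u x - v x).
Proof.
move=> Hu Hv; have Fu := HsVrad_Hnorm2_fin Hu; have Fv := HsVrad_Hnorm2_fin Hv.
move: Hu Hv => [mu_ up gu Vu ru] [mv vp gv Vv rv].
have muv : measurable_fun setT (fun x => u x - v x) by exact: measurable_funB.
have Fuv : (Hnorm2 mu s V (fun x => u x - v x)%R < +oo)%E.
  apply: (le_lt_trans (Hnorm2_sub mu_ mv)).
  by rewrite -(fineK Fu) -(fineK Fv) -EFinD -EFinM ltry.
split; first exact: muv.
- have p0 (w : RN R N -> R) (x : RN R N) : setT x -> (0 <= (`|w x| `^ p)%:E)%E by rewrite lee_fin powR_ge0.
  apply: (@le_lt_trans _ _ ((2 `^ p)%:E * (\int[mu]_x (`|u x| `^ p)%:E + \int[mu]_x (`|v x| `^ p)%:E))%E).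
    rewrite -(ge0_integralD mu measurableT (p0 u) (mpow mu_) (p0 v) (mpow mv)).
    rewrite -(ge0_integralZl_EFin mu measurableT _ (emeasurable_funD (mpow mu_) (mpow mv)) (powR_ge0 2 p)); last first.
      by move=> y _; rewrite adde_ge0// p0.
    apply: (ge0_le_integral mu measurableT (p0 _) (mpow muv)).
      by apply: measurable_funeM; apply: emeasurable_funD; exact: mpow.
    move=> x _; rewrite -EFinD -EFinM lee_fin.
    have uv : `|u x - v x| <= 2 * Num.max `|u x| `|v x|.
      apply: (le_trans (ler_normB _ _)); rewrite mulr2n mulrDl mul1r lerD//.
        by rewrite le_max lexx.
      by rewrite le_max lexx orbT.
    have m0 : 0 <= Num.max `|u x| `|v x| by rewrite le_max normr_ge0.
    apply: (@le_trans _ _ ((2 * Num.max `|u x| `|v x|) `^ p)).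
      by apply: ge0_ler_powR; rewrite ?nnegrE ?(ltW p_gt0) ?mulr_ge0.
    rewrite powRM// ler_wpM2l ?powR_ge0//.
    by case: (leP `|u x| `|v x|) => _; [rewrite lerDr|rewrite lerDl]; exact: powR_ge0.
  by apply: lte_mul_pinfty; [rewrite lee_fin powR_ge0|by []|exact: lte_add_pinfty].
- by apply: le_lt_trans Fuv; rewrite /Hnorm2 leeDl// Vpart_ge0.
- by apply: le_lt_trans Fuv; rewrite /Hnorm2 leeDr.
by move=> x y xy; rewrite (ru _ _ xy) (rv _ _ xy).
Qed.

Lemma HsVrad_radial_bound r : 0 < r -> exists2 C, 0 <= C &
  forall u t, HsVrad mu s V u -> 0 <= t -> (Hnorm mu s V u <= t%:E)%E ->
  {ae mu, forall x : RN R N, r <= enorm x -> `|u x| <= C * t}.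
Proof.
move=> r0; exists (supC mu s (N := N) * (r `^ (s - N%:R / 2) / Num.sqrt c0)).
  apply: mulr_ge0; first exact: supC_ge0.
  by rewrite divr_ge0 ?powR_ge0 ?sqrtr_ge0.
move=> u t [mu_ up _ _ ru] t0 ut.
have g0 : 0 <= t / Num.sqrt c0 by rewrite divr_ge0 ?sqrtr_ge0.
have := radial_bound mu_leb N_gt0 s_gt2 s_ltN mu_ ru g0 (gag_le_Hnorm mu_ t0 ut) p_gt0 up r0.
apply: filterS => x hx /hx /le_trans; apply.
by rewrite le_eqVlt; apply/orP; left; apply/eqP; ring.
Qed.

(** The radial bound with [t = 0] makes [u] vanish outside each ball of radius [1/(n+1)], and the
    origin is a null set. *)
Let HsVrad_ae0 (u : RN R N -> R) : HsVrad mu s V u -> (Hnorm mu s V u <= 0)%E ->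
  {ae mu, forall x : RN R N, u x = 0}.
Proof.
move=> Hu u0.
have h (n : nat) : {ae mu, forall x : RN R N, n.+1%:R^-1 <= enorm x -> u x = 0}.
  have n0 : 0 < n.+1%:R^-1 :> R by rewrite invr_gt0.
  have [C _ hC] := HsVrad_radial_bound n0.
  apply: filterS (hC u 0 Hu (lexx _) u0) => x hx /hx.
  by rewrite mulr0 normr_le0 => /eqP.
apply: filterS2 (ae_foralln h) (ae_enorm_gt0 mu_leb N_gt0) => x hx x0.
have [n hn] := ltr_add_invr x0; apply: (hx n).
by rewrite add0r in hn; exact: ltW.
Qed.

(* Homogeneity turns a bound on the unit sphere into a bound on the whole
   space; elements of norm 0 vanish almost everywhere. *)
Lemma wint_le_homogeneous q D sig : 0 < q -> measurable D -> 0 <= sig ->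
  (forall u, HsVrad mu s V u -> Hnorm mu s V u = 1%E -> (wint mu K q D u <= sig%:E)%E) ->
  forall u t, HsVrad mu s V u -> 0 <= t -> (Hnorm mu s V u <= t%:E)%E ->
  (wint mu K q D u <= (sig * t `^ q)%:E)%E.
Proof.
move=> q0 mD sig0 hsig u t Hu t0 ut.
have mu_ : measurable_fun setT u by case: Hu.
have Fu := HsVrad_Hnorm2_fin Hu.
have X0 : 0 <= fine (Hnorm2 mu s V u) by rewrite fine_ge0// Hnorm2_ge0.
pose h := Num.sqrt (fine (Hnorm2 mu s V u)).
have XE : Hnorm2 mu s V u = (h ^+ 2)%:E by rewrite sqr_sqrtr// fineK.
have h0 : 0 <= h by exact: sqrtr_ge0.
have ht : h <= t.
  move: ut; rewrite Hnorm_le// XE lee_fin => h2.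
  by rewrite -(ler_pXn2r (n := 2))// ?nnegrE.
move: h0; rewrite le_eqVlt => /orP[/eqP h0|h0].
  have u0 := HsVrad_ae0 Hu.
  have {}u0 : {ae mu, forall x : RN R N, u x = 0}.
    by apply: u0; rewrite Hnorm_le// XE -h0.
  apply: (@le_trans _ _ (wint mu K q D (fun=> 0))).
    apply: wint_ae_le => //; first exact: ltW.
    by apply: filterS u0 => x -> _.
  rewrite /wint (eq_integral (cst 0%E)); last first.
    by move=> x _; rewrite normr0 powR0 ?gt_eqF// mulr0.
  by rewrite integral0 lee_fin mulr_ge0// powR_ge0.
pose w := (fun x => h^-1 * u x).
have hV : 0 <= h^-1 by rewrite invr_ge0 ltW.
have Hw : HsVrad mu s V w by exact: HsVrad_scale.
have nw : Hnorm mu s V w = 1%E.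
  rewrite /Hnorm Hnorm2_scale// XE -EFinM exprVn mulVf ?expf_neq0 ?gt_eqF//.
  by rewrite poweR_EFin powR1.
have mw : measurable_fun setT w by case: Hw.
have -> : u = (fun x => h * w x).
  by apply/funext => x; rewrite /w mulrA divff ?mul1r// gt_eqF.
rewrite (wint_scale mu_leb N_gt0 cK K_ge0 q mD mw (ltW h0)).
apply: (@le_trans _ _ ((h `^ q)%:E * sig%:E)%E).
  by rewrite lee_wpmul2l ?lee_fin ?powR_ge0// hsig.
rewrite -EFinM lee_fin mulrC ler_wpM2l//.
by apply: ge0_ler_powR; rewrite ?nnegrE ?(ltW q0) ?(ltW h0).
Qed.

End Embedding.

(** * The compact embedding *)

Section CompactEmbedding.
Context {R : realType} {N : nat}.
Variable mu : {sigma_finite_measure set (RN R N) -> \bar R}.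
Hypothesis mu_leb : is_lebesgue mu.
Hypothesis N_ge2 : (2 <= N)%N.
Variables (s q1 q2 : R) (V K : R -> R).
Hypotheses (s_gt2 : 2^-1 < s) (s_lt1 : s < 1).
Hypotheses (q1_gt1 : 1 < q1) (q2_gt1 : 1 < q2).
Hypothesis cV : forall r, 0 < r -> {for r, continuous V}.
Hypothesis V_ge0 : forall r, 0 < r -> 0 <= V r.
Hypothesis cK : forall r, 0 < r -> {for r, continuous K}.
Hypothesis K_ge0 : forall r, 0 < r -> 0 <= K r.
Hypothesis S0_cvg : S0 mu s V K q1 r @[r --> 0^'+] --> 0%E.
Hypothesis Sinf_cvg : Sinf mu s V K q2 r @[r --> +oo] --> 0%E.

Let N_gt0 : (0 < N)%N. Proof. exact: ltnW. Qed.
Let q1_gt0 : 0 < q1. Proof. exact: lt_trans q1_gt1. Qed.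
Let q2_gt0 : 0 < q2. Proof. exact: lt_trans q2_gt1. Qed.

Let H := HsVrad mu s V.
Let nrm := Hnorm mu s V.
Let B (r : R) : set (RN R N) := Defs.ball0 r.
Let mB r : measurable (B r). Proof. exact: measurable_ball0. Qed.
Let mBc r : measurable (~` B r). Proof. by apply: measurableC. Qed.

Let H_meas u : H u -> measurable_fun setT u. Proof. by case. Qed.

Let S0_small sig : 0 < sig -> exists2 r, 0 < r &
  forall u t, H u -> 0 <= t -> (nrm u <= t%:E)%E ->
  (wint mu K q1 (B r) u <= (sig * t `^ q1)%:E)%E.
Proof.
move=> sig0.
have h : \forall r \near 0^'+, (S0 mu s V K q1 r < sig%:E)%E.
  have nb : nbhs (0%E : \bar R) [set y | (y < sig%:E)%E].
    by apply: open_ereal_lt'; rewrite lte_fin.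
  exact: (S0_cvg nb).
have [r [r0 hr]] := filter_ex (filterI (nbhs_right_gt (0 : R)) h).
exists r => //; apply: wint_le_homogeneous => //; first exact: ltW.
move=> u Hu nu; apply: ltW; apply: le_lt_trans hr.
by apply: ereal_sup_ubound; exists u.
Qed.

(** The requirement [r0 <= r] places the outer radius beyond the inner one supplied by [S0_small],
    leaving an annulus in between. *)
Let Sinf_small sig r0 : 0 < sig -> exists2 r, r0 <= r &
  forall u t, H u -> 0 <= t -> (nrm u <= t%:E)%E ->
  (wint mu K q2 (~` B r) u <= (sig * t `^ q2)%:E)%E.
Proof.
move=> sig0.
have h : \forall r \near +oo, (Sinf mu s V K q2 r < sig%:E)%E.
  have nb : nbhs (0%E : \bar R) [set y | (y < sig%:E)%E].
    by apply: open_ereal_lt'; rewrite lte_fin.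
  exact: (Sinf_cvg nb).
have [r [rr0 hr]] := filter_ex (filterI (nbhs_pinfty_gt (num_real r0)) h).
exists r; first exact: ltW.
apply: wint_le_homogeneous => //; first exact: ltW.
move=> u Hu nu; apply: ltW; apply: le_lt_trans hr.
by apply: ereal_sup_ubound; exists u.
Qed.

Let wint_split r r' u : r <= r' -> measurable_fun setT u ->
  wint mu K q1 (B r') u =
  (wint mu K q1 (B r) u + wint mu K q1 [set x : RN R N | (r <= enorm x < r')%R] u)%E.
Proof.
move=> rr' mu_.
have mA : measurable [set x : RN R N | (r <= enorm x < r')%R].
  have -> : [set x : RN R N | (r <= enorm x < r')%R] = ~` B r `&` B r'.
    apply/seteqP; split=> x; rewrite /B/Defs.ball0/=.
      by move=> /andP[h1 h2]; split=> //; apply/negP; rewrite -leNgt.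
    by move=> [/negP]; rewrite -leNgt => -> ->.
  by apply: measurableI.
rewrite -(wint_setU mu_leb N_gt0 cK K_ge0 q1 (mB r) mA _ mu_); last first.
  apply/disj_set2P; apply/seteqP; split=> // x [] /=; rewrite /B/Defs.ball0/=.
  by move=> h1 /andP[h2 _]; have := lt_le_trans h1 h2; rewrite ltxx.
congr (wint _ _ _ _ _); apply/seteqP; split=> x; rewrite /B/Defs.ball0/=.
  by move=> xr'; have [xr|xr] := ltP (enorm x) r; [left|right; rewrite xr' andbT].
by move=> [/lt_le_trans|/andP[_]//]; exact.
Qed.

Let embedding_bounds : exists r A, 0 <= A /\
  forall u t, H u -> 0 <= t -> (nrm u <= t%:E)%E ->
  (wint mu K q1 (B r) u <= ((A * t) `^ q1)%:E)%E /\
  (wint mu K q2 (~` B r) u <= ((A * t) `^ q2)%:E)%E.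
Proof.
have [r0 r0_gt0 h0] := S0_small ltr01.
have [r1 r01 h1] := Sinf_small r0 ltr01.
have [kap kap0 hkap] := wint_annulus mu_leb N_gt0 cK K_ge0 r1 r0_gt0.
have [C C0 hC] := HsVrad_radial_bound mu_leb N_ge2 s_gt2 s_lt1 cV V_ge0 r0_gt0.
(* The 1 pays for the small ball, where [sig = 1], and [kap * C ^ q1] for the annulus. As [X >= 1],
   its root [A] is at least 1 and also absorbs the bound outside the large ball. *)
pose X := 1 + kap * C `^ q1.
have X1 : 1 <= X by rewrite lerDl mulr_ge0// powR_ge0.
pose A := X `^ q1^-1.
have A1 : 1 <= A.
  rewrite -(powRr0 X); apply: ler_powR => //.
  by rewrite invr_ge0 ltW.
have A0 : 0 <= A by rewrite (le_trans _ A1).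
have AX : A `^ q1 = X.
  by rewrite /A -powRrM mulVf ?gt_eqF// powRr1// (le_trans _ X1).
exists r1, A; split=> // u t Hu t0 ut; have mu_ := H_meas Hu; split.
  rewrite (wint_split r01 mu_).
  have hann : {ae mu, forall x : RN R N, r0 <= enorm x < r1 -> `|u x| <= C * t}.
    by apply: filterS (hC u t Hu t0 ut) => x hx /andP[/hx].
  apply: (le_trans (leeD (h0 u t Hu t0 ut)
    (hkap q1 u (C * t) (ltW q1_gt0) (mulr_ge0 C0 t0) mu_ hann))).
  rewrite -EFinD lee_fin !powRM// AX /X.
  by rewrite le_eqVlt; apply/orP; left; apply/eqP; ring.
apply: (le_trans (h1 u t Hu t0 ut)); rewrite lee_fin mul1r.
by apply: ge0_ler_powR; rewrite ?nnegrE ?(ltW q2_gt0) ?mulr_ge0// ler_peMl.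
Qed.

Let HsVrad_in_sum u : H u -> in_sum mu K q1 q2 u /\
  forall r A t, 0 <= A -> 0 <= t -> nrm u = t%:E ->
  (wint mu K q1 (B r) u <= ((A * t) `^ q1)%:E)%E ->
  (wint mu K q2 (~` B r) u <= ((A * t) `^ q2)%:E)%E ->
  (sum_norm mu K q1 q2 u <= A%:E * nrm u)%E.
Proof.
move=> Hu; have mu_ := H_meas Hu.
have [r [A [A0 hA]]] := embedding_bounds.
have Fu := HsVrad_Hnorm2_fin mu_leb N_ge2 s_gt2 s_lt1 cV V_ge0 Hu.
split; last first.
  move=> r' A' t A'0 t0 -> h1 h2; rewrite -EFinM.
  by case: (sum_norm_le mu_leb N_gt0 cK K_ge0 q1_gt0 q2_gt0 (mulr_ge0 A'0 t0) mu_ h1 h2).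
pose t := fine (nrm u).
have nf : nrm u = t%:E by rewrite /t /nrm /Hnorm -(fineK Fu) poweR_EFin.
have t0 : 0 <= t by rewrite fine_ge0// poweR_ge0.
have ut : (nrm u <= t%:E)%E by rewrite nf.
have [h1 h2] := hA u t Hu t0 ut.
by case: (sum_norm_le mu_leb N_gt0 cK K_ge0 q1_gt0 q2_gt0 (mulr_ge0 A0 t0) mu_ h1 h2).
Qed.

Let sum_norm_ge0 u : (0 <= sum_norm mu K q1 q2 u)%E.
Proof.
apply: le_ereal_inf_tmp => _ [u1 [u2 [_ _ _ ->]]].
by rewrite le_max poweR_ge0.
Qed.

(** * The limit of a subsequence that is uniformly Cauchy on annuli *)

Section Sequence.
Variables (un : nat -> RN R N -> R) (M : R).
Hypotheses (Hun : forall n, H (un n)) (unM : forall n, (nrm (un n) <= M%:E)%E).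

Let M_ge0 : 0 <= M.
Proof. by rewrite -lee_fin (le_trans _ (unM 0))// poweR_ge0. Qed.

Let mun n : measurable_fun setT (un n). Proof. exact: H_meas. Qed.

Variable phi : nat -> nat.
Hypothesis phi_cauchy : forall r r' delta, 0 < r -> 0 < delta ->
  exists n0, forall n m, (n0 <= n)%N -> (n0 <= m)%N ->
    {ae mu, forall x : RN R N, r <= enorm x < r' -> `|un (phi n) x - un (phi m) x| <= delta}.

(** The upper limit exists at every point and is measurable in [x], so the limit function is defined
    everywhere although convergence holds only almost everywhere. *)
Let v (x : RN R N) : R := fine (limn_esup (fun n => (un (phi n) x)%:E)).

Let mv : measurable_fun setT v.
Proof.
apply: (@measurableT_comp _ _ _ _ _ _ fine _ (fun x : RN R N => limn_esup (fun n => (un (phi n) x)%:E))).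
  exact: fine_measurable.
by apply: measurable_fun_limn_esup => n; apply/measurable_EFinP.
Qed.

Let ae_cvg : {ae mu, forall x : RN R N, un (phi n) x @[n --> \oo] --> v x}.
Proof.
have h (j : nat) : exists n0 : nat, {ae mu, forall x : RN R N, forall n m, (n0 <= n)%N -> (n0 <= m)%N ->
    j.+1%:R^-1 <= enorm x < j.+1%:R -> `|un (phi n) x - un (phi m) x| <= j.+1%:R^-1}.
  have j0 : 0 < j.+1%:R^-1 :> R by rewrite invr_gt0.
  have [n0 hn0] := phi_cauchy j.+1%:R j0 j0; exists n0.
  apply: ae_foralln => n; apply: ae_foralln => m.
  have [n0n|n0n] := leqP n0 n; last by apply: nearW.
  have [n0m|n0m] := leqP n0 m; last by apply: nearW.
  by apply: filterS (hn0 n m n0n n0m) => x hx _ _ /hx.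
have [n0 hn0] := choice h.
apply: filterS2 (ae_foralln hn0) (ae_enorm_gt0 mu_leb N_gt0) => x hx x0.
suff cu : cvgn (fun n => un (phi n) x).
  have ce : (un (phi n) x)%:E @[n --> \oo] --> (limn (fun n => un (phi n) x))%:E.
    by apply: cvg_EFin; [exact: nearW|exact: cu].
  by rewrite /v (cvg_limn_einf_sup ce).2.
apply/cauchy_cvgP; apply: cauchy_exP => e e0.
have [j1 hj1] := ltr_add_invr x0; rewrite add0r in hj1.
have [j2 hj2] := ltr_add_invr e0; rewrite add0r in hj2.
(* One index controls everything: past [j1] the inner radius is below [|x|], past [j2] the tolerance
   is below [e], and past the integer part of [|x|] the outer radius exceeds [|x|]. *)
pose j := maxn (maxn j1 j2) (Num.truncn (enorm x)).
have inv_le i : (i <= j)%N -> j.+1%:R^-1 <= i.+1%:R^-1 :> R.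
  by move=> ij; rewrite lef_pV2 ?posrE// ler_nat ltnS.
exists (un (phi (n0 j)) x); exists (n0 j) => // n /= n0n.
rewrite /ball/=; apply: le_lt_trans (hx j (n0 j) n (leqnn _) n0n _) _.
  apply/andP; split; first by rewrite (le_trans (inv_le j1 _) (ltW hj1))// !leq_max leqnn.
  by rewrite (lt_le_trans (truncnS_gt _))// ler_nat ltnS leq_max leqnn orbT.
by rewrite (le_lt_trans (inv_le j2 _) hj2)// !leq_max leqnn orbT.
Qed.

Let diff n m (x : RN R N) : R := un (phi n) x - un (phi m) x.

Let Hdiff n m : H (diff n m).
Proof. exact: (HsVrad_sub mu_leb N_ge2 s_gt2 s_lt1 cV V_ge0 (Hun (phi n)) (Hun (phi m))). Qed.

Let nrm_diff n m : (nrm (diff n m) <= (2 * M)%:E)%E.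
Proof.
have mdf : measurable_fun setT (diff n m) by exact: H_meas.
have M2 : 0 <= 2 * M by rewrite mulr_ge0.
rewrite /nrm (Hnorm_le mu_leb N_ge2 s_gt2 s_lt1 cV V_ge0 mdf M2).
have hn i : (Hnorm2 mu s V (un (phi i)) <= (M ^+ 2)%:E)%E.
  by rewrite -(Hnorm_le mu_leb N_ge2 s_gt2 s_lt1 cV V_ge0 (mun _) M_ge0); exact: unM.
apply: (le_trans (Hnorm2_sub mu_leb N_ge2 s_gt2 s_lt1 cV V_ge0 (mun _) (mun _))).
apply: (@le_trans _ _ (2%:E * ((M ^+ 2)%:E + (M ^+ 2)%:E))%E).
  by rewrite lee_wpmul2l// leeD.
by rewrite -EFinD -EFinM lee_fin; nra.
Qed.

(** Order of choices: [r] makes the small ball cost at most half of [eps ^ q1], then [r'] makes the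
    exterior cost at most [eps ^ q2], then [kap] is fixed by the annulus, and [delta] makes the
    annulus cost the other half of [eps ^ q1]. *)
Let limit_close eps : 0 < eps -> exists n0, forall n, (n0 <= n)%N ->
  (sum_norm mu K q1 q2 (fun x => un (phi n) x - v x)%R <= eps%:E)%E.
Proof.
move=> eps0.
have M2 : 0 <= 2 * M by rewrite mulr_ge0.
pose T1 := (2 * M) `^ q1; pose T2 := (2 * M) `^ q2.
have T10 : 0 <= T1 by exact: powR_ge0.
have T20 : 0 <= T2 by exact: powR_ge0.
have e10 : 0 < eps `^ q1 by exact: powR_gt0.
have e20 : 0 < eps `^ q2 by exact: powR_gt0.
(* Dividing by [T + 1] covers the case [T = 0], which occurs when [M = 0]. *)
have small (e T : R) : 0 < e -> 0 <= T -> e / (T + 1) * T <= e.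
  move=> e0 T0; rewrite -mulrA ler_piMr ?(ltW e0)// mulrC ler_pdivrMr ?mul1r; lra.
have [r r0 h1] := S0_small (divr_gt0 (divr_gt0 e10 (ltr0Sn R 1)) (ltr_wpDl T10 ltr01)).
have [r' rr' h2] := Sinf_small r (divr_gt0 e20 (ltr_wpDl T20 ltr01)).
have [kap kap0 hkap] := wint_annulus mu_leb N_gt0 cK K_ge0 r' r0.
pose y := eps `^ q1 / 2 / (kap + 1).
have kap1 : 0 < kap + 1 by lra.
have y0 : 0 < y by rewrite !divr_gt0.
pose delta := y `^ q1^-1.
have d0 : 0 < delta by exact: powR_gt0.
have dE : delta `^ q1 = y by rewrite /delta -powRrM mulVf ?gt_eqF// powRr1// ltW.
have [n0 hn0] := phi_cauchy r' r0 d0.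
exists n0 => n n0n.
have bound1 m : (n0 <= m)%N -> (wint mu K q1 (B r') (diff n m) <= (eps `^ q1)%:E)%E.
  move=> n0m; have mdf := H_meas (Hdiff n m).
  rewrite (wint_split rr' mdf).
  apply: (le_trans (leeD (h1 _ _ (Hdiff n m) M2 (nrm_diff n m))
    (hkap q1 (diff n m) delta (ltW q1_gt0) (ltW d0) mdf (hn0 n m n0n n0m)))).
  rewrite dE -EFinD lee_fin -/T1.
  have e2 : 0 < eps `^ q1 / 2 by rewrite divr_gt0.
  have := small _ _ e2 T10; have := small _ _ e2 kap0; rewrite -/y (mulrC y).
  lra.
have bound2 m : (wint mu K q2 (~` B r') (diff n m) <= (eps `^ q2)%:E)%E.
  apply: (le_trans (h2 _ _ (Hdiff n m) M2 (nrm_diff n m))).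
  by rewrite lee_fin; exact: small.
have mnv : measurable_fun setT (fun x => un (phi n) x - v x) by exact: measurable_funB.
(* The second index is shifted by [n0] so that the bounds hold for every term of the sequence to
   which Fatou is applied. *)
have cvd : {ae mu, forall x : RN R N, diff n (m + n0)%N x @[m --> \oo] --> un (phi n) x - v x}.
  apply: filterS ae_cvg => x cx; apply: cvgB; first exact: cvg_cst.
  have := cx; rewrite -(cvg_shiftn n0); exact.
have mdf m : measurable_fun setT (diff n (m + n0)%N) by exact: H_meas (Hdiff _ _).
have b1 := wint_le_of_ae_cvg mu_leb N_gt0 cK K_ge0 (ltW q1_gt0) (mB r') mdf mnv cvd
  (fun m => bound1 _ (leq_addl m n0)).
have b2 := wint_le_of_ae_cvg mu_leb N_gt0 cK K_ge0 (ltW q2_gt0) (mBc r') mdf mnv cvd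
  (fun m => bound2 (m + n0)%N).
by case: (sum_norm_le mu_leb N_gt0 cK K_ge0 q1_gt0 q2_gt0 (ltW eps0) mnv b1 b2).
Qed.

Lemma limit_in_sum : in_sum mu K q1 q2 v /\
  (fun n => sum_norm mu K q1 q2 (fun x => un (phi n) x - v x)%R) @ \oo --> 0%E.
Proof.
split.
  have [r [A [A0 hA]]] := embedding_bounds.
  have h n := hA _ _ (Hun (phi n)) M_ge0 (unM (phi n)).
  have b1 := wint_le_of_ae_cvg mu_leb N_gt0 cK K_ge0 (ltW q1_gt0) (mB r) (fun n => mun (phi n))
    mv ae_cvg (fun n => (h n).1).
  have b2 := wint_le_of_ae_cvg mu_leb N_gt0 cK K_ge0 (ltW q2_gt0) (mBc r) (fun n => mun (phi n))
    mv ae_cvg (fun n => (h n).2).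
  by case: (sum_norm_le mu_leb N_gt0 cK K_ge0 q1_gt0 q2_gt0 (mulr_ge0 A0 M_ge0) mv b1 b2).
have fin e : 0 < e -> \forall n \near \oo,
    (sum_norm mu K q1 q2 (fun x => un (phi n) x - v x)%R <= e%:E)%E.
  by move=> e0; have [n0 hn0] := limit_close e0; exists n0.
apply/fine_cvgP; split.
  apply: filterS (fin 1 ltr01) => n hn.
  by rewrite ge0_fin_numE// (le_lt_trans hn)// ltry.
apply/cvgrPdist_le => e e0; apply: filterS (fin e e0) => n hn.
have fn : sum_norm mu K q1 q2 (fun x => un (phi n) x - v x)%R \is a fin_num.
  by rewrite ge0_fin_numE// (le_lt_trans hn)// ltry.
by rewrite sub0r normrN /= ger0_norm ?fine_ge0// -lee_fin fineK.
Qed.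

End Sequence.

Lemma HsVrad_compact_embedding : compact_embedding mu s V K q1 q2.
Proof.
split.
- by move=> u Hu; case: (HsVrad_in_sum Hu).
- have [r [A [A0 hA]]] := embedding_bounds.
  exists A => u Hu; have [_ h] := HsVrad_in_sum Hu.
  have Fu := HsVrad_Hnorm2_fin mu_leb N_ge2 s_gt2 s_lt1 cV V_ge0 Hu.
  pose t := fine (nrm u).
  have nf : nrm u = t%:E by rewrite /t /nrm /Hnorm -(fineK Fu) poweR_EFin.
  have t0 : 0 <= t by rewrite fine_ge0// poweR_ge0.
  have ut : (nrm u <= t%:E)%E by rewrite nf.
  have [h1 h2] := hA u t Hu t0 ut.
  exact: h h1 h2.
move=> un Hun [M unM].
have M_ge0 : 0 <= M by rewrite -lee_fin (le_trans _ (unM 0%N))// poweR_ge0.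
have c0 : 0 <= CNs mu s / 2.
  by rewrite divr_ge0// ltW// CNs_gt0// (lt_trans _ s_gt2).
have g0 : 0 <= M / Num.sqrt (CNs mu s / 2) by rewrite divr_ge0// sqrtr_ge0.
have s_ltN : 2 * s < N%:R.
  have : 2 <= N%:R :> R by rewrite ler_nat.
  by have := s_lt1; lra.
have p0 : 0 < crit_exp N s.
  by rewrite /crit_exp divr_gt0 ?subr_gt0// mulr_gt0// ltr0n.
have [phi [phi_inc hphi]] := @radial_subsequence _ _ mu mu_leb N_gt0 s s_gt2 s_ltN un
  (M / Num.sqrt (CNs mu s / 2)) (crit_exp N s) (fun n => H_meas (Hun n))
  (fun n => let: And5 _ _ _ _ ru := Hun n in ru) g0
  (fun n => gag_le_Hnorm mu_leb N_ge2 s_gt2 s_lt1 cV V_ge0 (H_meas (Hun n)) M_ge0 (unM n))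
  p0 (fun n => let: And5 _ up _ _ _ := Hun n in up).
exists phi; split=> //.
have := limit_in_sum Hun unM hphi.
by set v := (fun x => fine _) => hv; exists v.
Qed.

End CompactEmbedding.

Theorem theorem3p3 (R : realType) (N : nat)
  (mu : {measure set (RN R N) -> \bar R}) (s q1 q2 : R) (V K : R -> R) :
  is_lebesgue mu ->
  (2 <= N)%N ->
  2^-1 < s < 1 ->
  1 < q1 -> 1 < q2 ->
  (forall r, 0 < r -> {for r, continuous V}) ->
  (forall r, 0 < r -> 0 <= V r) ->
  (forall r, 0 < r -> {for r, continuous K}) ->
  (forall r, 0 < r -> 0 < K r) ->
  S0 mu s V K q1 r @[r --> 0^'+] --> 0%E ->
  Sinf mu s V K q2 r @[r --> +oo] --> 0%E ->
  compact_embedding mu s V K q1 q2.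
Proof.
move=> mu_leb N_ge2 /andP[s_gt2 s_lt1] q1_gt1 q2_gt1 cV V_ge0 cK K_gt0 hS0 hSinf.
(* Tonelli requires sigma-finiteness, which follows from the volumes of the boxes; [nu] is [mu]
   equipped with that structure. *)
have sfin := lebesgue_sigma_finite mu_leb.
pose nu : {sigma_finite_measure set (RN R N) -> \bar R} := HB.pack (Measure.sort mu)
  (@isSFinite.Build _ (RN R N) R mu (sfinite_measure_sigma_finite sfin))
  (@isSigmaFinite.Build _ (RN R N) R mu sfin).
exact: (@HsVrad_compact_embedding R N nu mu_leb N_ge2 s q1 q2 V K s_gt2 s_lt1 q1_gt1 q2_gt1
  cV V_ge0 cK (fun r r0 => ltW (K_gt0 r r0)) hS0 hSinf).
Qed.
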